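(* Let $G$ be a connected graph. Then $G$ is IndPP-extremal if and only if $G$ satisfies one of the following: (i) all blocks of $G$ are odd complete graphs; (ii) all blocks of $G$ except one are odd complete graphs, and the unique block of $G$ that is not an odd complete graph is even and IndPP-extremal.
   Context: All graphs are finite, simple, and nonnull (at least one vertex). A graph $G$ is even (resp. odd) if $|V(G)|$ is even (resp. odd). An induced path in $G$ is an induced subgraph of $G$ that is a path (possibly with only one vertex). An induced path partition (IndPP) of $G$ is a collection of induced paths in $G$ whose vertex sets partition $V(G)$; $\text{indpp}(G)$ is the smallest cardinality of an IndPP of $G$. The matching number $\nu(G)$ is the largest cardinality of a matching of $G$. $G$ is IndPP-extremal if $\text{indpp}(G) = |V(G)|-\nu(G)$. A cut-vertex of a graph $G$ on at least two vertices is a vertex $v$ such that $G \setminus v$ has more connected components than $G$. A graph is biconnected if it is connected and has no cut-vertices (so all complete graphs, including those on one and two vertices, are biconnected). A block of $G$ is a maximal biconnected induced subgraph of $G$. *)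

(* Defs.v *)
From mathcomp Require Import all_boot.

Set Implicit Arguments.
Unset Strict Implicit.
Unset Printing Implicit Defensive.

(* Finite simple graphs. The null graph is allowed here, so that vertex
   deletion is total; nonnullness is required explicitly where it matters. *)
Record sgraph := SGraph {
  vertex :> finType;
  adj : rel vertex;
  adj_sym : symmetric adj;
  adj_irrefl : irreflexive adj
}.

Section Induced.
Variables (G : sgraph) (A : {set G}).

Definition induced_adj : rel {x : G | x \in A} := relpre val (@adj G).

Lemma induced_adj_sym : symmetric induced_adj.
Proof. by move=> x y; apply: adj_sym. Qed.

Lemma induced_adj_irrefl : irreflexive induced_adj.
Proof. by move=> x; apply: adj_irrefl. Qed.

Definition induced : sgraph := SGraph induced_adj_sym induced_adj_irrefl.

End Induced.

Definition even_graph (G : sgraph) : bool := ~~ odd #|G|.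
Definition odd_graph (G : sgraph) : bool := odd #|G|.

Definition complete (G : sgraph) : bool :=
  [forall x : G, forall y : G, (x != y) ==> adj x y].

Definition connected (G : sgraph) : bool :=
  [forall x : G, forall y : G, connect (@adj G) x y].

Definition num_components (G : sgraph) : nat := n_comp (@adj G) predT.

(* The vertices can be listed without repetition so that two of them are
   adjacent exactly when they are consecutive. *)
Definition is_path (G : sgraph) : bool :=
  (0 < #|G|) &&
  [exists f : {ffun 'I_#|G| -> G},
     injectiveb f &&
     [forall i : 'I_#|G|, forall j : 'I_#|G|,
        adj (f i) (f j) == ((i.+1 == j :> nat) || (j.+1 == i :> nat))]].

(* An induced path is represented by its vertex set. *)
Definition is_indpp (G : sgraph) (P : {set {set G}}) : bool :=
  partition P [set: G] && [forall A in P, is_path (induced A)].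

Lemma card_induced (G : sgraph) (A : {set G}) : #|induced A| = #|A|.
Proof. by rewrite card_sig; apply: eq_card => x; rewrite inE. Qed.

Lemma is_path_set1 (G : sgraph) (x : G) : is_path (induced [set x]).
Proof.
have n1 : #|induced [set x]| = 1 by rewrite card_induced cards1.
have ord1 (i j : 'I_#|induced [set x]|) : i = j.
  have val0 (k : 'I_#|induced [set x]|) : k = 0 :> nat.
    by apply/eqP; rewrite -leqn0 -ltnS -[X in _ < X]n1 ltn_ord.
  by apply: val_inj; rewrite /= !val0.
rewrite /is_path {1}n1; apply/existsP.
exists [ffun i => enum_val i]; apply/andP; split.
  by apply/injectiveP => i j _; apply: ord1.
apply/forallP => i; apply/forallP => j.
by rewrite (ord1 j i) adj_irrefl orbb gtn_eqF.
Qed.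

Lemma is_indpp_ex (G : sgraph) :
  exists k, [exists P : {set {set G}}, is_indpp P && (#|P| == k)].
Proof.
pose P := [set [set x] | x : G].
exists #|P|; apply/existsP; exists P; rewrite eqxx andbT.
apply/andP; split; last first.
  by apply/forallP=> A; apply/implyP => /imsetP[x _ ->]; apply: is_path_set1.
apply/and3P; split.
- apply/eqP/setP => x; rewrite inE; apply/bigcupP.
  by exists [set x]; rewrite ?inE //; apply: imset_f.
- apply/trivIsetP => _ _ /imsetP[x _ ->] /imsetP[y _ ->] xy.
  by rewrite disjoints1 inE; apply: contra xy => /eqP ->.
- by apply/imsetP => -[x _ /setP/(_ x)]; rewrite !inE eqxx.
Qed.

Definition indpp (G : sgraph) : nat := ex_minn (is_indpp_ex G).

Definition edges (G : sgraph) : {set {set G}} :=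
  [set [set p.1; p.2] | p : G * G & adj p.1 p.2].

Definition is_matching (G : sgraph) (M : {set {set G}}) : bool :=
  (M \subset edges G) && trivIset M.

Definition matching_number (G : sgraph) : nat :=
  \max_(M : {set {set G}} | is_matching M) #|M|.

(* The subtraction never truncates, since matching_number G <= #|G|. *)
Definition indpp_extremal (G : sgraph) : bool :=
  indpp G == #|G| - matching_number G.

Definition cut_vertex (G : sgraph) (v : G) : bool :=
  (1 < #|G|) && (num_components G < num_components (induced [set~ v])).

Definition biconnected (G : sgraph) : bool :=
  connected G && [forall v : G, ~~ cut_vertex v].

Definition is_block (G : sgraph) (B : {set G}) : bool :=
  maxset (fun A : {set G} => (A != set0) && biconnected (induced A)) B.

Definition odd_complete (G : sgraph) : bool := odd_graph G && complete G.

(* Main.v *)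
Require Import Defs.
From mathcomp Require Import all_boot zify.

(** A matching is an induced path partition into edges and single vertices, so
    extremality says that no induced path partition has more edges in its paths
    than a maximum matching has. Everything is done for vertex subsets [A] of
    one fixed graph, so that pieces of the graph can be cut off and glued.

    Rigidity. In an extremal [A], take a maximum matching that leaves [u]
    unmatched and let [y], matched to [y'], be a neighbour of [u]. If [u] and
    [y'] were not adjacent, the induced path [u y y'] would replace the edge
    [y y'] and gain an edge. So [u] is adjacent to [y'], and the unmatched
    vertex slides from [u] to [y] when [u] is rematched to [y']
    ([extremal_nonadj_improve], [slideP]). If [A] is connected, sliding one
    unmatched vertex towards another shows that at most one is left
    ([extremal_almost_perfect]).

    Odd sets. Sliding leaves any chosen vertex [v] unmatched. The key lemma
    [nbr_clique] says that if [A] minus [v] is connected then the neighbours of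
    [v] form a clique: adjacency splits them into cliques, closed under every
    matching that leaves only [v] unmatched, and sliding from one clique to
    another inside [A] minus [v] contradicts rigidity on arrival. Hence a
    biconnected odd extremal set is complete. Rigidity is inherited by the two
    sides of a cut-vertex, so by induction all blocks are odd cliques
    ([slidable_odd_blocks]). Conversely, a path meets an odd clique in at most
    two vertices, and extremality survives gluing a connected odd extremal set
    at a vertex ([extremal_glue]), because the odd side has a perfect matching
    once the gluing vertex is removed and a path crosses the vertex at most
    once.

    Even sets. There is a perfect matching. At a cut-vertex [v], matched to [w],
    let [C] be a component of [A] minus [v] that does not contain [w]. Then [C]
    is perfectly matched, and [A] minus [C] is again even and extremal. The odd
    side, [C] with [v], is rigid except possibly for slides onto [v], because
    the edge [v w] hanging off it can serve to prolong paths at [v]; the key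
    lemma needs only this weak rigidity and then yields the missing case
    ([pendant_slidable]). So the odd side has odd complete blocks, and
    induction on the even side finds the exceptional block
    ([even_extremal_blocks]). *)

Set Implicit Arguments.
Unset Strict Implicit.
Unset Printing Implicit Defensive.

(** * Connected vertex subsets *)

Definition within (G : sgraph) (A : {set G}) : rel G :=
  fun x y => [&& x \in A, y \in A & adj x y].

Definition conn (G : sgraph) (A : {set G}) : bool :=
  [forall x in A, forall y in A, connect (within A) x y].

Lemma within_sym (G : sgraph) (A : {set G}) : symmetric (within A).
Proof. by move=> x y; rewrite /within andbCA adj_sym. Qed.

Lemma connP (G : sgraph) (A : {set G}) :
  reflect {in A &, forall x y, connect (within A) x y} (conn A).
Proof.
apply: (iffP forall_inP) => [cA x y Ax Ay | cA x Ax].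
  by apply: (forall_inP (cA x Ax)).
by apply/forall_inP => y Ay; apply: cA.
Qed.

Lemma connect_within_ind (G : sgraph) (A : {set G}) (S : G -> Prop) x y :
  connect (within A) x y -> S x ->
  (forall a b, a \in A -> b \in A -> adj a b -> S a -> S b) -> S y.
Proof.
case/connectP=> p pth -> Sx step.
elim: p x Sx pth => //= b p IHp x Sx /andP[/and3P[Ax Ab ab]].
exact/IHp/(step x b).
Qed.

Lemma conn_ind (G : sgraph) (A : {set G}) (S : G -> Prop) x y :
  conn A -> x \in A -> S x ->
  (forall a b, a \in A -> b \in A -> adj a b -> S a -> S b) ->
  y \in A -> S y.
Proof.
move=> /connP cA Ax Sx step Ay.
exact: connect_within_ind (cA x y Ax Ay) Sx step.
Qed.

Lemma conn_hub (G : sgraph) (A : {set G}) v :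
  (forall x, x \in A -> connect (within A) v x) -> conn A.
Proof.
move=> hub; apply/connP => x y Ax Ay.
apply: (connect_trans _ (hub y Ay)).
by rewrite (sym_connect_sym (within_sym A)) hub.
Qed.

(** * Matchings as involutions *)

(** The partner function: unmatched vertices are the fixed points. Behaviour
    outside [A] is left free, so that restriction to a closed subset of [A] is
    the same function. *)
Definition matching_on (G : sgraph) (A : {set G}) (m : G -> G) : Prop :=
  forall x, x \in A -> [/\ m x \in A, m (m x) = x & m x = x \/ adj x (m x)].

Definition unmatched (G : sgraph) (A : {set G}) (m : G -> G) : {set G} :=
  [set x in A | m x == x].

Definition near_perfect (G : sgraph) (A : {set G}) (m : G -> G) u : Prop :=
  matching_on A m /\ unmatched A m = [set u].

(** The matching obtained from [m] when the unmatched vertex [u] takes over the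
    partner of [y], which leaves [y] unmatched. *)
Definition slide (G : sgraph) (m : G -> G) (u y : G) : G -> G :=
  fun z => if z == y then y else if z == u then m y
           else if z == m y then u else m z.

Lemma matching_on_id (G : sgraph) (A : {set G}) : matching_on A id.
Proof. by move=> x Ax; split=> //; left. Qed.

Lemma adj_neq (G : sgraph) (x y : G) : adj x y -> x != y.
Proof. by apply: contraTneq => ->; rewrite adj_irrefl. Qed.

Lemma matching_on_inj (G : sgraph) (A : {set G}) m x y :
  matching_on A m -> x \in A -> y \in A -> (m x == m y) = (x == y).
Proof.
move=> mA Ax Ay; apply/eqP/eqP => [e|->//].
by have [_ <- _] := mA x Ax; have [_ <- _] := mA y Ay; rewrite e.
Qed.

Lemma slideP (G : sgraph) (A : {set G}) m u y :
  matching_on A m -> u \in A -> m u = u -> y \in A -> adj u y -> m y != y ->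
  adj u (m y) ->
  matching_on A (slide m u y) /\
  unmatched A (slide m u y) = y |: unmatched A m :\ u.
Proof.
move=> mA Au mu Ay uy my umy.
have [Amy mmy _] := mA y Ay.
have [uNy uNmy] := (adj_neq uy, adj_neq umy).
split.
  move=> z Az; rewrite /slide; have [->|zy] := eqVneq z y.
    by rewrite eqxx; split=> //; left.
  have [->|zu] := eqVneq z u.
    rewrite (negPf my) [m y == u]eq_sym (negPf uNmy) eqxx.
    by split=> //; right.
  have [->|zmy] := eqVneq z (m y).
    rewrite (negPf uNy) eqxx; split=> //; right; by rewrite adj_sym.
  have [Amz mmz mz] := mA z Az.
  have -> : (m z == y) = (z == m y) by rewrite -{1}mmy (matching_on_inj mA).
  have -> : (m z == u) = (z == u) by rewrite -{1}mu (matching_on_inj mA).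
  have -> : (m z == m y) = (z == y) by rewrite (matching_on_inj mA).
  by rewrite (negPf zmy) (negPf zu) (negPf zy).
apply/setP=> z; rewrite !inE /slide; have [->|zy] := eqVneq z y.
  by rewrite eqxx Ay.
have [->|zu] := eqVneq z u; first by rewrite eq_sym (negPf uNmy) andbF.
have [->|//] := eqVneq z (m y).
by rewrite (negPf uNmy) mmy eq_sym (negPf my) !andbF.
Qed.

Lemma near_perfect_mem (G : sgraph) (A : {set G}) m u :
  near_perfect A m u -> u \in A /\ m u = u.
Proof. by case=> _ /setP/(_ u); rewrite !inE eqxx => /andP[-> /eqP]. Qed.

Lemma near_perfectE (G : sgraph) (A : {set G}) m u x :
  near_perfect A m u -> x \in A -> (m x == x) = (x == u).
Proof. by case=> _ /setP/(_ x); rewrite !inE => + Ax; rewrite Ax. Qed.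

Lemma near_perfect_slide (G : sgraph) (A : {set G}) m u y :
  near_perfect A m u -> y \in A -> adj u y -> adj u (m y) ->
  near_perfect A (slide m u y) y.
Proof.
move=> nm Ay uy umy; have [Au mu] := near_perfect_mem nm; have [mA fu] := nm.
have [|mA' fu'] := slideP mA Au mu Ay uy _ umy.
  by rewrite (near_perfectE nm Ay) eq_sym adj_neq.
by split=> //; rewrite fu' fu setDv setU0.
Qed.

Lemma swap_unmatched (G : sgraph) (A : {set G}) m u w :
  matching_on A m -> u \in A -> w \in A -> m u = u -> m w = w -> adj u w ->
  exists2 m', matching_on A m' & #|unmatched A m'| < #|unmatched A m|.
Proof.
move=> mA Au Aw mu mw uw; have uNw := adj_neq uw.
exists (fun z => if z == u then w else if z == w then u else m z).
  move=> z Az; have [->|zu] := eqVneq z u.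
    rewrite eqxx [w == u]eq_sym (negPf uNw); split=> //; by right.
  have [->|zw] := eqVneq z w; first by rewrite eqxx adj_sym; split=> //; right.
  have [Amz mmz mz] := mA z Az.
  have -> : (m z == u) = (z == u) by rewrite -{1}mu (matching_on_inj mA).
  have -> : (m z == w) = (z == w) by rewrite -{1}mw (matching_on_inj mA).
  by rewrite (negPf zu) (negPf zw).
apply: proper_card; apply/properP; split.
  apply/subsetP=> z; rewrite !inE; have [->|zu] := eqVneq z u.
    by rewrite eq_sym (negPf uNw) andbF.
  by have [->|zw] := eqVneq z w; rewrite ?(negPf uNw) ?andbF.
by exists u; rewrite !inE ?Au ?mu ?eqxx // eq_sym (negPf uNw) andbF.
Qed.

Lemma improvable_almost_perfect (G : sgraph) (A : {set G}) :
  (forall m u w, matching_on A m -> u \in A -> w \in A -> m u = u -> m w = w ->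
     u != w ->
     exists2 m', matching_on A m' & #|unmatched A m'| < #|unmatched A m|) ->
  exists2 m, matching_on A m & #|unmatched A m| <= 1.
Proof.
move=> impr; have [m mA] : exists m, matching_on A m.
  by exists id; apply: matching_on_id.
have [n] := ubnP #|unmatched A m|; elim: n m mA => // n IHn m mA lt_n.
have [le1|gt1] := leqP #|unmatched A m| 1; first by exists m.
have /card_gt1P[u [w [uF wF uw]]] := gt1.
move: uF wF; rewrite !inE => /andP[Au /eqP mu] /andP[Aw /eqP mw].
have [m' mA' lt'] := impr m u w mA Au Aw mu mw uw.
by apply: (IHn m') => //; apply: leq_trans lt' _.
Qed.

Lemma matching_onU (G : sgraph) (A1 A2 : {set G}) m1 m2 :
  [disjoint A1 & A2] -> matching_on A1 m1 -> matching_on A2 m2 ->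
  matching_on (A1 :|: A2) (fun x => if x \in A1 then m1 x else m2 x) /\
  unmatched (A1 :|: A2) (fun x => if x \in A1 then m1 x else m2 x) =
    unmatched A1 m1 :|: unmatched A2 m2.
Proof.
move=> d12 mA1 mA2; split.
  move=> x; rewrite !inE; case: ifP => [A1x _ | A1x /= A2x].
    by have [A1m mm am] := mA1 x A1x; rewrite A1m.
  have [A2m mm am] := mA2 x A2x; rewrite A2m orbT.
  by rewrite (disjointFl d12 A2m).
apply/setP=> x; rewrite !inE; case: ifP => //= A1x.
by rewrite (disjointFr d12 A1x) orbF.
Qed.

Lemma matching_onD (G : sgraph) (A X : {set G}) m :
  matching_on A m -> (forall x, x \in X -> x \in A -> m x \in X) ->
  matching_on (A :\: X) m.
Proof.
move=> mA mX x; rewrite !inE => /andP[Xx Ax].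
have [Amx mmx amx] := mA x Ax; split=> //; rewrite Amx andbT.
by apply: contra Xx => Xmx; rewrite -mmx mX.
Qed.

Lemma matching_onI (G : sgraph) (A X : {set G}) m :
  matching_on A m -> X \subset A -> (forall x, x \in X -> m x \in X) ->
  matching_on X m.
Proof.
move=> mA /subsetP XA mX x Xx; have [_ mmx amx] := mA x (XA x Xx).
by split=> //; apply: mX.
Qed.

(** * Rigidity and the neighbourhood of an unmatched vertex *)

(** Rigidity. The exceptional set [E] is empty for odd extremal sets; it is
    [[set v]] when extremality only controls paths that end at [v]. *)
Definition slidable (G : sgraph) (A E : {set G}) : Prop :=
  forall m u y, near_perfect A m u -> y \in A :\: E -> adj u y -> adj u (m y).

Lemma near_perfect_val (G : sgraph) (A : {set G}) m u x :
  near_perfect A m u -> x \in A -> x != u ->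
  [/\ m x \in A, m x != u, m (m x) = x & adj x (m x)].
Proof.
move=> nm Ax xu; have [Au mu] := near_perfect_mem nm; have [mA _] := nm.
have [Am mm am] := mA x Ax; split=> //.
  by rewrite -{1}mu (matching_on_inj mA).
by case: am => // /eqP; rewrite (near_perfectE nm Ax) (negPf xu).
Qed.

Lemma slide_id (G : sgraph) (m : G -> G) u y z :
  z != y -> z != u -> z != m y -> slide m u y z = m z.
Proof. by rewrite /slide => /negPf -> /negPf -> /negPf ->. Qed.

Lemma slide_partner (G : sgraph) (m : G -> G) u y :
  m y != y -> m y != u -> slide m u y (m y) = u.
Proof. by rewrite /slide => /negPf -> /negPf ->; rewrite eqxx. Qed.

Lemma slidable_slide (G : sgraph) (A E : {set G}) m u y :
  slidable A E -> near_perfect A m u -> y \in A :\: E -> adj u y ->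
  near_perfect A (slide m u y) y.
Proof.
move=> sA nm yAE uy; apply: near_perfect_slide => //; last exact: sA.
by case/setDP: yAE.
Qed.

(** Slide from [v] to [a]: now [a] is unmatched while [c] still has its old
    partner. *)
Lemma nbr_adj_partner (G : sgraph) (A : {set G}) v m a c :
  slidable A [set v] -> near_perfect A m v -> a \in A -> c \in A ->
  adj v a -> adj v c -> adj a c -> c != m a -> adj a (m c).
Proof.
move=> sA nm Aa Ac va vc ac cma.
have Dv x : adj v x -> x \in A -> x \in A :\: [set v].
  by move=> vx Ax; rewrite !inE Ax eq_sym adj_neq.
have := sA _ _ c (slidable_slide sA nm (Dv a va Aa) va) (Dv c vc Ac) ac.
by rewrite slide_id // eq_sym adj_neq.
Qed.

(** In the generic case [a], [p], [c] lie in three different edges of the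
    matching. Write [x'] for the partner of [x]. Sliding along [v], [a], [p'],
    [c] leaves [c] unmatched and [p] matched to [a], so that rigidity at the
    edge from [c] to [p] makes [c] adjacent to [a]. *)
Lemma nbr_adj_trans (G : sgraph) (A : {set G}) v m a p c :
  slidable A [set v] -> near_perfect A m v ->
  a \in A -> p \in A -> c \in A -> adj v a -> adj v p -> adj v c ->
  adj a p -> adj p c -> a != c -> adj a c.
Proof.
move=> sA nm Aa Ap Ac va vp vc ap pc aNc.
have E0 x y : x \in A -> y \in A -> adj v x -> adj v y -> adj x y ->
  y != m x -> adj x (m y) by exact: nbr_adj_partner.
have Nv x : adj v x -> x != v by move/adj_neq; rewrite eq_sym.
have [Ama mav mma ama] := near_perfect_val nm Aa (Nv a va).
have [Amp mpv mmp pmp] := near_perfect_val nm Ap (Nv p vp).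
have [Amc mcv mmc cmc] := near_perfect_val nm Ac (Nv c vc).
have [mac|mac] := eqVneq (m a) c; first by rewrite -mac.
have mca : m c != a by apply: contraNneq mac => <-; rewrite mmc.
have [mpa|mpa] := eqVneq (m p) a.
  rewrite adj_sym -mpa E0 // 1?adj_sym //.
  by apply: contraNneq aNc => e; rewrite -mpa e mmc.
have [mpc|mpc] := eqVneq (m p) c.
  rewrite -mpc E0 //.
  by apply: contraNneq aNc => e; rewrite -mpc e mma.
have pma : p != m a by apply: contraNneq mpa => ->; rewrite mma.
have pmc : p != m c by apply: contraNneq mpc => ->; rewrite mmc.
have aNp := adj_neq ap; have pNc := adj_neq pc.
have amp : adj a (m p) by apply: E0.
have cmp : adj c (m p) by apply: E0 => //; rewrite adj_sym.
(* The slides v to a, a to p', p' to c; each mk is followed on p and c. *)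
pose m1 := slide m v a.
have n1 : near_perfect A m1 a.
  by apply: (slidable_slide sA) => //; rewrite !inE Aa Nv.
have mpma : m p != m a.
  by apply: contraNneq aNp => e; rewrite -mma -e mmp.
have mpmc : m p != m c.
  by apply: contraNneq pNc => e; rewrite -mmp e mmc.
have m1mp : m1 (m p) = p by rewrite /m1 slide_id.
have cma : c != m a by rewrite eq_sym.
have m1c : m1 c = m c by rewrite /m1 slide_id ?Nv 1?eq_sym.
pose m2 := slide m1 a (m p).
have n2 : near_perfect A m2 (m p).
  by apply: (slidable_slide sA) => //; rewrite !inE Amp mpv.
have m2c : m2 c = m c.
  by rewrite /m2 slide_id ?m1mp // eq_sym.
have m2p : m2 p = a.
  by rewrite /m2 -{2}m1mp slide_partner // m1mp ?(adj_neq pmp) // eq_sym.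
pose m3 := slide m2 (m p) c.
have n3 : near_perfect A m3 c.
  by apply: (slidable_slide sA n2); rewrite ?inE ?Ac ?Nv // adj_sym.
have m3p : m3 p = a.
  by rewrite /m3 slide_id ?m2c // adj_neq.
rewrite adj_sym -m3p; apply: (sA _ _ _ n3); rewrite 1?adj_sym //.
by rewrite !inE Ap Nv.
Qed.

(** Suppose that [a] is not in the class [K] of [c] under adjacency among the
    neighbours of [v]. Both [K] and its complement are closed under [m]. Slide
    from [v] to [a] and on along a walk avoiding [v] and [K]; the edges of the
    matching inside [K] are untouched. If the walk, now at [p], can enter [K] at
    [x], rigidity makes [p] adjacent to the partner [x'] of [x]. But sliding
    instead along [v], [x], [p] leaves [p] unmatched and [x'] matched to [v],
    so [p] is adjacent to [v] and therefore lies in [K] already. So the walk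
    never reaches [c], although [A] minus [v] is connected. *)
Lemma nbr_clique (G : sgraph) (A : {set G}) v m a c :
  slidable A [set v] -> near_perfect A m v -> conn (A :\ v) ->
  a \in A -> c \in A -> adj v a -> adj v c -> a != c -> adj a c.
Proof.
move=> sA nm cA Aa Ac va vc aNc.
have Nv x : adj v x -> x != v by move/adj_neq; rewrite eq_sym.
case: (boolP (adj a c)) => // Nac; exfalso.
pose K := [set w in A | adj v w && ((w == c) || adj c w)].
have KA w : w \in K -> [/\ w \in A, adj v w & w != v].
  by rewrite inE => /and3P[Aw vw _]; rewrite Aw vw Nv.
have Kc : c \in K by rewrite inE Ac vc eqxx.
have Ka : a \notin K by rewrite inE Aa va (negPf aNc) adj_sym.
have Km w : w \in K -> m w \in K.
  move=> Kw; have [Aw vw wv] := KA w Kw.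
  have [Amw mwv mmw wmw] := near_perfect_val nm Aw wv.
  have vmw : adj v (m w).
    by apply: (sA _ _ _ nm) => //; rewrite !inE Aw wv.
  rewrite inE Amw vmw; move: Kw; rewrite inE Aw vw /= => /orP[/eqP e | cw].
    by rewrite -e wmw orbT.
  have [e|wmc] := eqVneq w (m c).
    by have [_ _ mmc _] := near_perfect_val nm Ac (Nv c vc); rewrite e mmc eqxx.
  by rewrite (nbr_adj_partner sA nm Ac Aw vc vw cw wmc) orbT.
have mK w : w \in A -> w != v -> m w \in K -> w \in K.
  by move=> Aw wv /Km; case: (near_perfect_val nm Aw wv) => _ _ ->.
have KN w p : w \in K -> p \in A -> adj v p -> adj w p -> p \in K.
  move=> Kw Ap vp wp; have [Aw vw wv] := KA w Kw; rewrite inE Ap vp /=.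
  have [//|pNc] := eqVneq p c; move: Kw; rewrite inE Aw vw /=.
  case/predU1P => [<- // | cw].
  by apply: (nbr_adj_trans sA nm Ac Aw Ap) => //; rewrite eq_sym.
pose S w := [/\ w \notin K, w != v
  & exists2 m', near_perfect A m' w & {in K, m' =1 m}].
suff: S c by case; rewrite Kc.
apply: (conn_ind cA) (_ : a \in A :\ v) _ _ _; rewrite ?inE ?Aa ?Ac ?Nv //.
  split=> //; first exact: Nv.
  exists (slide m v a).
    by apply: (slidable_slide sA) => //; rewrite !inE Aa Nv.
  move=> k Kk; have [Ak vk kv] := KA k Kk.
  rewrite slide_id //; first by apply: contraNneq Ka => <-.
  by apply: contraNneq Ka => e; apply: mK; rewrite ?Nv // -e.
move=> p x; rewrite !inE => /andP[pv Ap] /andP[xv Ax] px [Kp _ [m' n' eqm']].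
have xD : x \in A :\ v by rewrite !inE xv.
have pD : p \in A :\ v by rewrite !inE pv.
have Amx' : m' x \in A by case: n' => m'A _; case: (m'A x Ax).
have pmx' : adj p (m' x) by apply: (sA _ _ _ n').
case: (boolP (x \in K)) => Kx; last first.
  split=> //; exists (slide m' p x); first exact: (slidable_slide sA).
  move=> k Kk; have [Ak vk kv] := KA k Kk; rewrite slide_id ?(eqm' k) //.
  - by apply: contraNneq Kx => <-.
  - by apply: contraNneq Kp => <-.
  apply: contraNneq Kx => e.
  have <- : m k = x; last exact: Km.
  by rewrite -(eqm' k Kk) e; case: n' => m'A _; case: (m'A x Ax).
(* Entering K at x is impossible: slide along v, x, p instead. *)
exfalso; have [_ vx _] := KA x Kx.
have Nvp : ~~ adj v p.
  by apply: contra Kp => vp; apply: (KN x); rewrite // adj_sym.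
have [Amx mxv mmx xmx] := near_perfect_val nm Ax xv.
have [Amp mpv mmp pmp] := near_perfect_val nm Ap pv.
rewrite eqm' // in pmx'.
have xNp : x != p by rewrite eq_sym adj_neq.
have pNmx : p != m x by apply: contraNneq Kp => ->; apply: Km.
have n1 : near_perfect A (slide m v x) x by apply: (slidable_slide sA).
have m1p : slide m v x p = m p by rewrite slide_id // eq_sym.
have n2 : near_perfect A (slide (slide m v x) x p) p.
  by apply: (slidable_slide sA) => //; rewrite adj_sym.
have mxD : m x \in A :\ v by rewrite !inE mxv.
case/negP: Nvp; rewrite adj_sym.
have /= := sA _ _ _ n2 mxD pmx'.
rewrite (slide_id (m := slide m v x)) ?slide_partner //.
- by rewrite eq_sym adj_neq.
- by rewrite eq_sym.
- by rewrite eq_sym adj_neq.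
by rewrite m1p; case: (nm) => mA _; rewrite (matching_on_inj mA).
Qed.

(** Slide the unmatched vertex along a walk from [u] to [w]. *)
Lemma exists_near_perfect_at (G : sgraph) (A : {set G}) m u w :
  slidable A set0 -> near_perfect A m u -> conn A -> w \in A ->
  exists m', near_perfect A m' w.
Proof.
move=> sA nm cA Aw; have [Au _] := near_perfect_mem nm.
apply: (conn_ind (S := fun w => exists m', near_perfect A m' w) cA Au _ _ Aw).
  by exists m.
move=> a b Aa Ab ab [m' nm']; exists (slide m' a b).
by apply: (slidable_slide sA); rewrite ?inE.
Qed.

(** * Induced path partitions and extremality *)

(** An induced path once the entries are distinct, which [path_partition] demands
    of all its paths at once. *)
Fixpoint chordless (G : sgraph) (s : seq G) : bool :=
  if s is x :: t then
    (if t is y :: u then adj x y && all (fun z => ~~ adj x z) u else true)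
    && chordless t
  else true.

Definition path_partition (G : sgraph) (A : {set G}) (L : seq (seq G)) : Prop :=
  [/\ all (fun s => (s != [::]) && chordless s) L, uniq (flatten L)
    & flatten L =i A].

(** A matching [m] of [A] gives a path partition of [A] into
    [(#|A| + #|unmatched A m|) / 2] edges and single vertices, so this says that
    no path partition is smaller than all those that come from matchings. *)
Definition extremal (G : sgraph) (A : {set G}) : Prop :=
  forall L, path_partition A L ->
  exists2 m, matching_on A m & #|A| + #|unmatched A m| <= 2 * size L.

Lemma path_partition1 (G : sgraph) (s : seq G) :
  s != [::] -> chordless s -> uniq s -> path_partition [set x in s] [:: s].
Proof.
by move=> s0 cs us; split; rewrite /= ?s0 ?cs ?cats0 // => x; rewrite inE.
Qed.

Lemma path_partitionU (G : sgraph) (A1 A2 : {set G}) L1 L2 :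
  [disjoint A1 & A2] -> path_partition A1 L1 -> path_partition A2 L2 ->
  path_partition (A1 :|: A2) (L1 ++ L2).
Proof.
move=> d12 [c1 u1 e1] [c2 u2 e2].
split; rewrite ?all_cat ?c1 ?c2 ?flatten_cat //.
  rewrite cat_uniq u1 u2 andbT /=; apply/hasPn => x; rewrite e1 e2 => A2x.
  by rewrite (disjointFl d12 A2x).
by move=> x; rewrite mem_cat e1 e2 inE.
Qed.

Lemma matching_cover (G : sgraph) (A : {set G}) m :
  matching_on A m ->
  exists2 L, path_partition A L & 2 * size L = #|A| + #|unmatched A m|.
Proof.
have [n] := ubnP #|A|; elim: n A => // n IHn A ltAn mA.
have [->|[x Ax]] := set_0Vmem A.
  exists [::]; first by split=> // x; rewrite inE.
  suff -> : unmatched set0 m = set0 by rewrite cards0.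
  by apply/setP=> x; rewrite !inE.
have [Amx mmx xmx] := mA x Ax.
have mA' : matching_on (A :\: [set x; m x]) m.
  by apply: matching_onD => // y; rewrite !inE => /orP[]/eqP-> _;
     rewrite ?mmx eqxx ?orbT.
have sxA : [set x; m x] \subset A by apply/subsetP=> y /set2P[]->.
have cA := cardsD A [set x; m x]; rewrite (setIidPr sxA) cards2 in cA.
have leA : #|[set x; m x]| <= #|A| by exact: subset_leq_card.
rewrite cards2 in leA.
have [|L [cL uL eL] szL] := IHn _ _ mA'; first by rewrite cA; lia.
have [mx|mx] := eqVneq (m x) x.
  have xmx0 : (x != m x) = false by rewrite mx eqxx.
  exists ([:: x] :: L).
    split; rewrite /= ?cL //.
      by rewrite uL eL !inE eqxx.
    move=> y; rewrite inE eL !inE mx; have [->|] := eqVneq y x; by rewrite ?Ax.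
  have -> : unmatched A m = x |: unmatched (A :\: [set x; m x]) m.
    apply/setP=> y; rewrite !inE mx; have [->|] := eqVneq y x => //=.
    by rewrite Ax mx eqxx.
  rewrite cardsU1 /= !inE eqxx /=; rewrite xmx0 in cA leA; lia.
exists ([:: x; m x] :: L).
  split; rewrite /= ?cL ?andbT //.
  - by case: xmx => // e; rewrite e eqxx in mx.
  - by rewrite uL inE !eL !inE !eqxx orbT orbF eq_sym (negPf mx).
  move=> y; rewrite !inE eL !inE; have [->|] := eqVneq y x; first by rewrite Ax.
  by have [->|] := eqVneq y (m x).
have -> : unmatched A m = unmatched (A :\: [set x; m x]) m.
  apply/setP=> y; rewrite !inE; have [->|] := eqVneq y x.
    by rewrite (negPf mx) andbF.
  have [->|//] := eqVneq y (m x).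
  by rewrite mmx [x == m x]eq_sym (negPf mx) andbF orbT.
rewrite eq_sym mx in cA leA; rewrite /=; lia.
Qed.

Lemma odd_unmatched (G : sgraph) (A : {set G}) m :
  matching_on A m -> odd #|unmatched A m| = odd #|A|.
Proof. by move=> /matching_cover[L _]; lia. Qed.

(** The way extremality is used: paths partitioning [X], completed by a matching
    outside [X], form a path partition of [A]. *)
Lemma extremal_patch (G : sgraph) (A X : {set G}) L m :
  extremal A -> X \subset A -> path_partition X L -> matching_on (A :\: X) m ->
  exists2 m', matching_on A m'
    & #|X| + #|unmatched A m'| <= 2 * size L + #|unmatched (A :\: X) m|.
Proof.
move=> eA XA pX mX; have [L' pL' szL'] := matching_cover mX.
have dX : [disjoint X & A :\: X] by rewrite -setI_eq0 setDE setICA setICr setI0.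
have pA : path_partition A (L ++ L').
  have := path_partitionU dX pX pL'.
  by rewrite setDE setUIr setUCr setIT (setUidPr XA).
have [m' mA' le'] := eA _ pA; exists m' => //.
rewrite size_cat in le'.
have := cardsD A X; rewrite (setIidPr XA); have := subset_leq_card XA; lia.
Qed.

(** Replacing the edge [y, m y] by the induced path [u, y, m y] saves a path, so
    extremality provides a better matching. *)
Lemma extremal_nonadj_improve (G : sgraph) (A : {set G}) m u y :
  extremal A -> matching_on A m -> u \in A -> m u = u ->
  y \in A -> adj u y -> m y != y -> ~~ adj u (m y) ->
  exists2 m', matching_on A m' & #|unmatched A m'| < #|unmatched A m|.
Proof.
move=> eA mA Au mu Ay uy my umy; have [Amy mmy ymy] := mA y Ay.
have {}ymy : adj y (m y) by case: ymy => // e; rewrite e eqxx in my.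
have uNy := adj_neq uy; have yNmy := adj_neq ymy.
have uNmy : u != m y.
  by rewrite -mu (matching_on_inj mA).
pose X := [set x in [:: u; y; m y]].
have XA : X \subset A.
  by apply/subsetP=> x; rewrite !inE => /or3P[]/eqP->.
have us : uniq [:: u; y; m y] by rewrite /= !inE negb_or uNy uNmy yNmy.
have mX : matching_on (A :\: X) m.
  apply: matching_onD => // x; rewrite !inE => /or3P[]/eqP->; rewrite ?mu ?mmy.
  - by rewrite eqxx.
  - by rewrite eqxx !orbT.
  by rewrite eqxx orbT.
have pX : path_partition X [:: [:: u; y; m y]].
  by apply: path_partition1 => //; rewrite /= uy umy ymy.
have [m' mA' le'] := extremal_patch eA XA pX mX.
exists m' => //.
have cX : #|X| = 3 by rewrite cardsE (card_uniqP us).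
have : #|unmatched (A :\: X) m| < #|unmatched A m|.
  apply: proper_card; apply/properP; split.
    by apply/subsetP=> x; rewrite !inE => /andP[/andP[_ ->]].
  by exists u; rewrite !inE ?Au ?mu eqxx.
by rewrite cX /= in le'; move: le'; clear; lia.
Qed.

(** Two unmatched vertices [u] and [w] are brought together: [u] slides along a
    walk towards [w] until they are adjacent and can be matched, unless a slide
    is blocked and the matching improves for that reason. *)
Lemma extremal_almost_perfect (G : sgraph) (A : {set G}) :
  extremal A -> conn A -> exists2 m, matching_on A m & #|unmatched A m| <= 1.
Proof.
move=> eA cA; apply: improvable_almost_perfect => m u w mA Au Aw mu mw uNw.
pose better :=
  exists2 m', matching_on A m' & #|unmatched A m'| < #|unmatched A m|.
(* The walk carries the unmatched vertex z along edges while w stays put. *)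
pose S z := (z != w /\ exists m', [/\ matching_on A m', m' z = z, m' w = w
  & #|unmatched A m'| <= #|unmatched A m|]) \/ better.
suff [[]|//] : S w by rewrite eqxx.
apply: (conn_ind (S := S) cA Au) => //; first by left; split=> //; exists m.
move=> z y Az Ay zy [[zNw [m' [mA' mz' mw' le']]]|]; last by right.
have weaken :
    (exists2 m2, matching_on A m2 & #|unmatched A m2| < #|unmatched A m'|) ->
    better.
  by case=> m2 mA2 lt2; exists m2 => //; apply: leq_trans lt2 le'.
have [my|my] := eqVneq (m' y) y.
  by right; apply: weaken; apply: (swap_unmatched mA' Az Ay).
case: (boolP (adj z (m' y))) => zmy; last first.
  by right; apply: weaken; apply: (extremal_nonadj_improve eA mA' Az mz' Ay).
left; have [mA2 f2] := slideP mA' Az mz' Ay zy my zmy.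
have yNw : y != w by apply: contraNneq my => ->; rewrite mw'.
split=> //; exists (slide m' z y); split=> //.
- by rewrite /slide eqxx.
- rewrite slide_id // 1?eq_sym //.
  by rewrite -mw' (matching_on_inj mA') // eq_sym.
rewrite f2 cardsU1 !inE (negPf my) !andbF /=.
by move: le'; rewrite (cardsD1 z) inE Az mz' eqxx.
Qed.

(** By parity a matching better than a near-perfect one cannot exist. *)
Lemma extremal_slidable (G : sgraph) (A : {set G}) :
  extremal A -> odd #|A| -> slidable A set0.
Proof.
move=> eA oA m u y nm; rewrite setD0 => Ay uy.
have [Au mu] := near_perfect_mem nm; have [mA fm] := nm.
case: (boolP (adj u (m y))) => // umy; exfalso.
have my : m y != y by rewrite (near_perfectE nm) // eq_sym adj_neq.
have [m' mA'] := extremal_nonadj_improve eA mA Au mu Ay uy my umy.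
by have := odd_unmatched mA'; rewrite oA fm cards1; case: #|_|.
Qed.

Lemma extremal_odd_near_perfect (G : sgraph) (A : {set G}) :
  extremal A -> conn A -> odd #|A| -> exists m u, near_perfect A m u.
Proof.
move=> eA cA oA; have [m mA le1] := extremal_almost_perfect eA cA.
have := odd_unmatched mA; rewrite oA => odd_m.
have /cards1P[u fm] : #|unmatched A m| == 1 by case: #|_| le1 odd_m => [|[]].
by exists m, u.
Qed.

Lemma extremal_even_perfect (G : sgraph) (A : {set G}) :
  extremal A -> conn A -> ~~ odd #|A| ->
  exists2 m, matching_on A m & unmatched A m = set0.
Proof.
move=> eA cA oA; have [m mA le1] := extremal_almost_perfect eA cA.
have := odd_unmatched mA; rewrite (negPf oA) => even_m.
exists m => //; apply/eqP; rewrite -cards_eq0.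
by case: #|_| le1 even_m => [|[]].
Qed.

(** * Separations at a cut-vertex *)

(** Each side is [v] together with some of the components of [A] minus [v], which
    makes the notion symmetric in [A1] and [A2]. *)
Definition separation (G : sgraph) (A A1 A2 : {set G}) (v : G) : Prop :=
  [/\ A1 :|: A2 = A, A1 :&: A2 = [set v],
      forall x y, x \in A1 -> y \in A2 -> x != v -> y != v -> ~~ adj x y,
      conn A1 /\ conn A2 & 1 < #|A1| /\ 1 < #|A2|].

Lemma separation_sym (G : sgraph) (A A1 A2 : {set G}) v :
  separation A A1 A2 v -> separation A A2 A1 v.
Proof.
case=> UA IA nA [c1 c2] [s1 s2]; split=> //; rewrite 1?setUC 1?setIC //.
by move=> x y A2x A1y xv yv; rewrite adj_sym nA.
Qed.

Lemma separation_mem (G : sgraph) (A A1 A2 : {set G}) v :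
  separation A A1 A2 v -> v \in A1 /\ v \in A2.
Proof. by case=> _ /setP/(_ v) + _ _ _; rewrite !inE eqxx => /andP[]. Qed.

Lemma separation_only (G : sgraph) (A A1 A2 : {set G}) v x :
  separation A A1 A2 v -> x \in A1 -> x \in A2 -> x = v.
Proof.
by case=> _ /setP/(_ x) + _ _ _ A1x A2x; rewrite !inE A1x A2x => /esym/eqP.
Qed.

Lemma separation_sub (G : sgraph) (A A1 A2 : {set G}) v :
  separation A A1 A2 v -> A1 \subset A /\ A2 \subset A.
Proof. by case=> <- *; rewrite subsetUl subsetUr. Qed.

Lemma separation_card (G : sgraph) (A A1 A2 : {set G}) v :
  separation A A1 A2 v -> #|A| + 1 = #|A1| + #|A2|.
Proof.
by case=> <- IA *; rewrite -(cardsUI A1 A2) IA cards1.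
Qed.

Lemma separation_step (G : sgraph) (A A1 A2 : {set G}) v x y :
  separation A A1 A2 v -> x \in A1 -> y \in A -> x != v -> adj x y ->
  y \in A1.
Proof.
move=> sep A1x Ay xv xy; have [A1v A2v] := separation_mem sep.
have [UA _ nA _ _] := sep; case: (boolP (y \in A1)) => // A1y.
have A2y : y \in A2 by move: Ay; rewrite -UA inE (negPf A1y).
have yv : y != v by apply: contraNneq A1y => ->.
by have := nA x y A1x A2y xv yv; rewrite xy.
Qed.

Lemma chordless_cat (G : sgraph) (s t : seq G) :
  chordless (s ++ t) -> chordless s /\ chordless t.
Proof.
elim: s => //= x s IHs /andP[xs /IHs[-> ->]]; split=> //; rewrite andbT.
case: s xs {IHs} => //= y s /andP[-> ]; rewrite all_cat; by case/andP.
Qed.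

Lemma chordless_side (G : sgraph) (A A1 A2 : {set G}) v s :
  separation A A1 A2 v -> chordless s -> {subset s <= A} -> v \notin s ->
  all (mem A1) s || all (mem A2) s.
Proof.
move=> sep; elim: s => // x s IHs cs sA; rewrite inE negb_or eq_sym.
case/andP=> xv vs; have Ax : x \in A by apply: sA; rewrite inE eqxx.
case: s IHs cs sA vs => [|y s] IHs; rewrite [chordless _]/=.
  by move=> _ _ _; case: sep => UA *; move: Ax; rewrite -UA inE /= !andbT.
case/andP=> /andP[xy _] cs sA vs.
have sA' : {subset y :: s <= A} by move=> z zs; apply: sA; rewrite inE zs orbT.
have yv : y != v by move: vs; rewrite inE negb_or eq_sym => /andP[].
rewrite adj_sym in xy.
case/orP: (IHs cs sA' vs) => side; apply/orP; [left|right]; apply/andP.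
  by split=> //; apply: (separation_step sep _ Ax yv xy); case/andP: side.
split=> //; apply: (separation_step (separation_sym sep) _ Ax yv xy).
by case/andP: side.
Qed.

Lemma filter_side (G : sgraph) (A A1 A2 : {set G}) v s :
  separation A A1 A2 v -> chordless s -> {subset s <= A} -> v \notin s ->
  [seq z <- s | z \in A1] = s \/ [seq z <- s | z \in A1] = [::].
Proof.
move=> sep cs sA vs; case/orP: (chordless_side sep cs sA vs) => side.
  by left; apply/all_filterP.
right; apply/eqP; rewrite -[_ == _]negbK -has_filter -all_predC.
apply/allP=> x xs; apply/negP => /= A1x; case/negP: vs.
by rewrite -(separation_only sep A1x (allP side x xs)).
Qed.

(** A path passes through [v] at most once, and each of its two parts lies on
    one side; so its trace on a side is a contiguous piece of it. *)
Lemma chordless_filter (G : sgraph) (A A1 A2 : {set G}) v s :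
  separation A A1 A2 v -> chordless s -> {subset s <= A} -> uniq s ->
  chordless [seq z <- s | z \in A1].
Proof.
move=> sep cs sA us; have [A1v _] := separation_mem sep.
have [vs|vs] := boolP (v \in s); last first.
  by case: (filter_side sep cs sA vs) => ->.
case/splitPr: vs cs sA us => p q cs sA us.
have [cp cvq] := chordless_cat cs.
have cq : chordless q by case/andP: cvq.
have cpv : chordless (p ++ [:: v]).
  by have [] := @chordless_cat G (p ++ [:: v]) q; rewrite -?catA.
have [vp vq] : v \notin p /\ v \notin q.
  move: us; rewrite cat_uniq /= negb_or => /and4P[_ /andP[vp _] vq _].
  by rewrite vp vq.
have pA : {subset p <= A} by move=> x xp; apply: sA; rewrite mem_cat xp.
have qA : {subset q <= A}.
  by move=> x xq; apply: sA; rewrite mem_cat inE xq !orbT.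
rewrite filter_cat /= A1v.
case: (filter_side sep cp pA vp) => ->;
  by case: (filter_side sep cq qA vq) => ->.
Qed.

Lemma flatten_nonnil (T : eqType) (L : seq (seq T)) :
  flatten [seq s <- L | s != [::]] = flatten L.
Proof. by elim: L => //= -[|x s] L IHL /=; rewrite IHL. Qed.

Lemma uniq_flatten_mem (T : eqType) (L : seq (seq T)) s :
  uniq (flatten L) -> s \in L -> uniq s.
Proof.
move=> + sL; case/splitPr: sL => L1 L2.
by rewrite flatten_cat cat_uniq /= cat_uniq => /and3P[_ _ /and3P[]].
Qed.

Lemma count_mem_flatten (T : eqType) (L : seq (seq T)) x :
  uniq (flatten L) -> count (fun s => x \in s) L <= 1.
Proof.
elim: L => //= s L IHL; rewrite cat_uniq => /and3P[_ /hasPn sL uL].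
have [xs|_] := boolP (x \in s); last exact: IHL.
rewrite add1n ltnS leqn0 eqn0Ngt -has_count; apply/hasPn => t tL.
apply/negP => xt; suff /sL : x \in flatten L by rewrite /= xs.
by apply/flattenP; exists t.
Qed.

Definition restrict (G : sgraph) (B : {set G}) (L : seq (seq G))
    : seq (seq G) :=
  [seq s <- [seq [seq z <- s | z \in B] | s <- L] | s != [::]].

Lemma size_restrict (G : sgraph) (B : {set G}) (L : seq (seq G)) :
  size (restrict B L) = count (has (mem B)) L.
Proof.
by rewrite size_filter count_map; apply: eq_count => s /=; rewrite has_filter.
Qed.

Lemma path_partition_restrict (G : sgraph) (A A1 A2 : {set G}) v L :
  separation A A1 A2 v -> path_partition A L ->
  path_partition A1 (restrict A1 L).
Proof.
move=> sep [cL uL eL]; have [A1A _] := separation_sub sep.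
split.
- rewrite all_filter all_map; apply/allP=> s sL /=; apply/implyP => ->.
  apply: (chordless_filter sep); last exact: uniq_flatten_mem sL.
    by case/andP: (allP cL s sL).
  by move=> x xs; rewrite -eL; apply/flattenP; exists s.
- by rewrite flatten_nonnil -filter_flatten filter_uniq.
move=> x; rewrite flatten_nonnil -filter_flatten mem_filter eL.
by apply: andb_idr; apply: (subsetP A1A).
Qed.

(** Only the path through [v] meets both sides. *)
Lemma size_restrict_separation (G : sgraph) (A A1 A2 : {set G}) v L :
  separation A A1 A2 v -> path_partition A L ->
  size (restrict A1 L) + size (restrict A2 L) <= size L + 1.
Proof.
move=> sep [cL uL eL]; rewrite !size_restrict -count_predUI leq_add //.
  exact: count_size.
apply: leq_trans (count_mem_flatten v uL).
rewrite -!size_filter (_ : filter _ L = [seq s <- [seq s <- L | v \in s] |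
   predI (has (mem A1)) (has (mem A2)) s]).
  by rewrite !size_filter count_filter; apply: sub_count => s /andP[].
rewrite -filter_predI; apply: eq_in_filter => s sL /=; apply/esym/andb_idr.
case/andP=> /hasP[x xs A1x] /hasP[y ys A2y]; apply/negPn/negP => vs.
have sA : {subset s <= A} by move=> z zs; rewrite -eL; apply/flattenP; exists s.
have /andP[_ cs] := allP cL s sL.
case/orP: (chordless_side sep cs sA vs) => side; case/negP: vs.
  by rewrite -(separation_only sep (allP side y ys) A2y).
by rewrite -(separation_only sep A1x (allP side x xs)).
Qed.

Lemma separation_matching (G : sgraph) (A A1 A2 : {set G}) v m1 m2 :
  separation A A1 A2 v -> near_perfect A1 m1 v -> matching_on A2 m2 ->
  let m := fun x => if x \in A2 then m2 x else m1 x in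
  matching_on A m /\ unmatched A m = unmatched A2 m2.
Proof.
move=> sep n1 mA2 m; have [UA IA _ _ _] := sep.
have [A1v A2v] := separation_mem sep; have [m1A f1] := n1.
have eA : A2 :|: (A1 :\ v) = A.
  rewrite -UA; apply/setP=> x; rewrite !inE orbC.
  by have [->|] := eqVneq x v; rewrite ?A2v ?orbT.
have d : [disjoint A2 & A1 :\ v].
  rewrite -setI_eq0; apply/eqP/setP=> x; rewrite !inE.
  apply/and3P => -[A2x /eqP xv A1x]; exact: xv (separation_only sep A1x A2x).
have m1v : m1 v = v by case: (near_perfect_mem n1).
have m1D : matching_on (A1 :\ v) m1.
  by apply: matching_onD => // x /set1P -> _; rewrite m1v inE.
have [] := matching_onU d mA2 m1D; rewrite eA => mA ->; split=> //.
suff -> : unmatched (A1 :\ v) m1 = set0 by rewrite setU0.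
apply/setP=> x; move/setP/(_ x): f1; rewrite !inE.
by case: (eqVneq x v) => //= _ ->.
Qed.

(** A path partition [L] of [A] restricts to both sides and splits one path.
    As every matching of the odd set [A1] leaves a vertex unmatched, the trace
    of [L] on [A1] has at least [(#|A1| + 1) / 2] paths. This surplus of half a
    path and the vertex [v] counted on both sides pay for the split path, and a
    matching of [A2] extends by [m1] without any new unmatched vertex. *)
Lemma extremal_glue (G : sgraph) (A A1 A2 : {set G}) v m1 :
  separation A A1 A2 v -> near_perfect A1 m1 v -> odd #|A1| ->
  extremal A1 -> extremal A2 -> extremal A.
Proof.
move=> sep n1 o1 e1 e2 L pL.
have [m1' m1A le1] := e1 _ (path_partition_restrict sep pL).
have sep' := separation_sym sep.
have [m2 m2A le2] := e2 _ (path_partition_restrict sep' pL).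
have le := size_restrict_separation sep pL.
have [mA fm] := separation_matching sep n1 m2A.
exists (fun x => if x \in A2 then m2 x else m1 x) => //; rewrite fm.
have := odd_unmatched m1A; rewrite o1 => oF.
have := separation_card sep; move: oF le1 le2 le.
case: #|unmatched A1 m1'| => // k.
lia.
Qed.

(** * Blocks *)

Definition bicon (G : sgraph) (A : {set G}) : bool :=
  conn A && [forall v in A, conn (A :\ v)].

Definition block_of (G : sgraph) (A B : {set G}) : bool :=
  maxset (fun X : {set G} => [&& X \subset A, X != set0 & bicon X]) B.

Definition odd_clique (G : sgraph) (A : {set G}) : bool :=
  odd #|A| && [forall x in A, forall y in A, (x != y) ==> adj x y].

Lemma odd_cliqueP (G : sgraph) (A : {set G}) :
  reflect (odd #|A| /\ {in A &, forall x y, x != y -> adj x y}) (odd_clique A).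
Proof.
apply: (iffP andP) => -[oA cA]; split=> //.
  by move=> x y Ax Ay; apply/implyP; apply: (forall_inP (forall_inP cA x Ax)).
by apply/forall_inP=> x Ax; apply/forall_inP=> y Ay; apply/implyP; apply: cA.
Qed.

Lemma bicon_sep (G : sgraph) (A A1 A2 B : {set G}) v :
  separation A A1 A2 v -> bicon B -> B \subset A ->
  B \subset A1 \/ B \subset A2.
Proof.
move=> sep /andP[cB cutB] BA; have [A1v A2v] := separation_mem sep.
have [UA _ _ _ _] := sep.
have [|/subsetPn[x Bx A1x]] := boolP (B \subset A1); first by left.
have [|/subsetPn[y By A2y]] := boolP (B \subset A2); first by right.
have xv : x != v by apply: contraNneq A1x => ->.
have yv : y != v by apply: contraNneq A2y => ->.
have cBv : conn (B :\ v).
  have [Bv|Bv] := boolP (v \in B); first exact: (forall_inP cutB).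
  by rewrite (setDidPl _) // disjoint_sym disjoints1.
suff A2y' : y \in A2 by rewrite A2y' in A2y.
have BvA z : z \in B :\ v -> z \in A by case/setD1P=> _ /(subsetP BA).
apply: (conn_ind (S := fun z => z \in A2) cBv (_ : x \in _)).
- by rewrite !inE xv.
- by move: (subsetP BA x Bx); rewrite -UA inE (negPf A1x).
- move=> a b Ba Bb ab A2a.
  apply: (separation_step (separation_sym sep) A2a _ _ ab).
    exact: BvA.
  by case/setD1P: Ba.
by rewrite !inE yv.
Qed.

(** Walks from [v] in [A] change sides only at [v], so their final parts join
    [v] to every vertex of either side within that side. *)
Lemma component_separation (G : sgraph) (A : {set G}) v x y :
  conn A -> v \in A -> x \in A :\ v -> y \in A :\ v ->
  ~~ connect (within (A :\ v)) x y ->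
  exists C : {set G}, [/\ separation A (v |: C) (A :\: C) v, conn C,
    x \in C, y \notin C & v \notin C].
Proof.
move=> cA Av Dx Dy Nxy; set D := A :\ v in Dx Dy Nxy.
pose C := [set z in D | connect (within D) x z].
have CD z : z \in C -> z \in D by rewrite inE => /andP[].
have CA z : z \in C -> z \in A by move/CD; case/setD1P.
have vC : v \notin C by rewrite !inE eqxx.
have Cx : x \in C by rewrite inE Dx connect0.
have yC : y \notin C by rewrite inE Dy.
have stepC a b : a \in C -> b \in D -> adj a b -> b \in C.
  rewrite inE => /andP[Da xa] Db ab; rewrite inE Db.
  by apply: connect_trans xa (connect1 _); rewrite /within Da Db.
have cC : conn C.
  apply: (conn_hub (v := x)) => z; rewrite inE => /andP[_ xz].
  pose S z := z \in C /\ connect (within C) x z.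
  suff [] : S z by [].
  apply: (connect_within_ind (S := S) xz).
    by split; rewrite ?connect0.
  move=> a b _ Db ab [Ca xa]; have Cb := stepC a b Ca Db ab; split=> //.
  by apply: connect_trans xa (connect1 _); rewrite /within Ca Cb.
have yA : y \in A by case/setD1P: Dy.
have yv : y != v by case/setD1P: Dy.
exists C; split=> //; clearbody C.
pose A1 := v |: C; pose A2 := A :\: C.
have hub z : z \in A -> if z \in C then connect (within A1) v z
                     else connect (within A2) v z.
  apply: (conn_ind (S := fun z => if z \in C then connect (within A1) v z
                     else connect (within A2) v z) cA Av).
    by rewrite (negPf vC).
  move=> a b Aa Ab ab; have [->|bv] := eqVneq b v; first by rewrite (negPf vC).
  have [eav|av] := eqVneq a v.
    rewrite eav in ab *; rewrite (negPf vC) => _.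
    case: ifP => Cb; apply: connect1.
      by rewrite /within /A1 /A2 !inE Cb eqxx orbT.
    by rewrite /within /A1 /A2 !inE Cb vC Av Ab.
  have Da : a \in D by rewrite !inE av.
  have Db : b \in D by rewrite !inE bv.
  have -> : (b \in C) = (a \in C).
    apply/idP/idP => [Cb|Ca]; last exact: stepC Ca Db ab.
    by apply: (stepC b) => //; rewrite adj_sym.
  case: ifP => Ca va; apply: connect_trans va (connect1 _);
    rewrite /within /A1 /A2 !inE.
    by rewrite Ca (stepC a b Ca Db ab) !orbT.
  have -> : (b \in C) = false.
    by apply: contraFF Ca => Cb; apply: (stepC b) => //; rewrite adj_sym.
  by rewrite Ca Aa Ab.
split.
- apply/setP=> z; rewrite !inE; have [->|zv] := eqVneq z v; first by rewrite Av.
  by case Cz: (z \in C); rewrite //= (CA z Cz).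
- apply/setP=> z; rewrite !inE; have [->|zv] := eqVneq z v.
    by rewrite vC Av.
  by case: (z \in C).
- move=> a b /setU1P[-> _|Ca]; rewrite ?eqxx // => /setDP[Ab Cb] _ bv.
  by apply: contra Cb => ab; apply: stepC Ca _ ab; rewrite !inE bv.
- split; apply: (conn_hub (v := v)) => z.
    case/setU1P=> [->|Cz]; first exact: connect0.
    by have := hub z (CA z Cz); rewrite Cz.
  by case/setDP=> Az Cz; have := hub z Az; rewrite (negPf Cz).
split; apply/card_gt1P.
  exists v, x; rewrite !inE eqxx Cx orbT; split=> //.
  by apply: contraNneq vC => ->.
by exists v, y; rewrite !inE vC yC eq_sym.
Qed.

Lemma not_biconP (G : sgraph) (A : {set G}) :
  conn A -> ~~ bicon A ->
  exists v x y, [/\ v \in A, x \in A :\ v, y \in A :\ v &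
    ~~ connect (within (A :\ v)) x y].
Proof.
move=> cA; rewrite /bicon cA /= => /forall_inPn[v Av /forall_inPn[x Dx]].
by case/forall_inPn=> y Dy xy; exists v, x, y.
Qed.

(** A connected set that is not biconnected separates at a cut-vertex into two
    smaller connected sets. *)
Lemma separation_ind (G : sgraph) (P : {set G} -> Prop) :
  (forall A, A != set0 -> bicon A -> P A) ->
  (forall A A1 A2 v, conn A -> separation A A1 A2 v -> P A1 -> P A2 -> P A) ->
  forall A, A != set0 -> conn A -> P A.
Proof.
move=> base step A; have [n] := ubnP #|A|; elim: n A => // n IHn A ltA A0 cA.
have [bA|nbA] := boolP (bicon A); first exact: base.
have [v [x [y [Av Dx Dy xy]]]] := not_biconP cA nbA.
have [C [sep _ _ _ _]] := component_separation cA Av Dx Dy xy.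
have cardA := separation_card sep.
have [_ _ _ [c1 c2] [gt1 gt2]] := sep.
by apply: step cA sep _ _; apply: IHn; rewrite -?card_gt0 //;
  clear -ltA cardA gt1 gt2; lia.
Qed.

Lemma clique_conn (G : sgraph) (A : {set G}) :
  {in A &, forall x y, x != y -> adj x y} -> conn A.
Proof.
move=> kA; apply/connP => x y Ax Ay; have [->|xy] := eqVneq x y.
  exact: connect0.
by apply: connect1; rewrite /within Ax Ay kA.
Qed.

Lemma clique_bicon (G : sgraph) (A : {set G}) :
  {in A &, forall x y, x != y -> adj x y} -> bicon A.
Proof.
move=> kA; rewrite /bicon clique_conn //=; apply/forall_inP => v Av.
by apply: clique_conn => x y /setD1P[_ Ax] /setD1P[_ Ay]; apply: kA.
Qed.

Lemma block_ofP (G : sgraph) (A B : {set G}) :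
  reflect ([/\ B \subset A, B != set0, bicon B
     & forall X : {set G}, X \subset A -> bicon X -> B \subset X -> X = B])
    (block_of A B).
Proof.
apply: (iffP maxsetP) => [[/and3P[BA B0 bB] maxB]|[BA B0 bB maxB]].
  split=> // X XA bX BX; apply: maxB => //; rewrite XA bX andbT /=.
  by apply: contraNneq B0 => X0; rewrite X0 subset0 in BX.
by split=> [|X /and3P[XA _ bX]]; [rewrite BA B0 | exact: maxB].
Qed.

Lemma block_of_bicon (G : sgraph) (A B : {set G}) :
  A != set0 -> bicon A -> block_of A B = (B == A).
Proof.
move=> A0 bA; apply/block_ofP/eqP => [[BA _ _ maxB]|->].
  by rewrite (maxB A).
by split=> // X XA _ AX; apply/eqP; rewrite eqEsubset XA.
Qed.

(** A larger biconnected subset of [A] would have to lie in [A2], so the block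
    of [A1] would be [[set v]]; but [v] forms a biconnected set with any of its
    neighbours in [A1]. *)
Lemma block_of_side (G : sgraph) (A A1 A2 B : {set G}) v :
  separation A A1 A2 v -> block_of A1 B -> block_of A B.
Proof.
move=> sep /block_ofP[B1 B0 bB maxB]; have [A1A _] := separation_sub sep.
apply/block_ofP; split=> // [|X XA bX BX]; first exact: subset_trans B1 A1A.
have [X1|X2] := bicon_sep sep bX XA; first exact: maxB.
have Bv x : x \in B -> x = v.
  by move=> Bx; apply: (separation_only sep); [apply: (subsetP B1)
    | apply: (subsetP X2); apply: (subsetP BX)].
have [x Bx] := set0Pn _ B0.
have vB : v \in B by rewrite -(Bv x Bx).
have [A1v _] := separation_mem sep.
have [_ _ _ [c1 _] [/card_gt1P[a [b [A1a A1b ab]]] _]] := sep.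
have [w A1w wv] : exists2 w, w \in A1 & w != v.
  by have [e|av] := eqVneq a v; [exists b; rewrite // -e eq_sym | exists a].
have /existsP[z /andP[A1z vz]] : [exists z, (z \in A1) && adj v z].
  apply: contraTT isT => /existsPn no.
  suff /eqP e : w = v by rewrite e in wv.
  apply: (conn_ind (S := fun z => z = v) c1 A1v _ _ A1w) => // p q _ A1q pq pv.
  by have := no q; rewrite A1q -pv pq.
have e : [set v; z] = B.
  apply: maxB.
  - by apply/subsetP=> p /set2P[]->.
  - apply: clique_bicon => p q /set2P[]-> /set2P[]->; rewrite ?eqxx //.
    by rewrite adj_sym.
  by apply/subsetP=> p /Bv ->; rewrite !inE eqxx.
have zv : z = v by apply: Bv; rewrite -e !inE eqxx orbT.
by rewrite zv adj_irrefl in vz.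
Qed.

Lemma block_of_separation (G : sgraph) (A A1 A2 B : {set G}) v :
  separation A A1 A2 v -> block_of A B = block_of A1 B || block_of A2 B.
Proof.
move=> sep; have [A1A A2A] := separation_sub sep.
apply/idP/orP => [/block_ofP[BA B0 bB maxB]|[]]; last 2 first.
- exact: (block_of_side sep).
- exact: (block_of_side (separation_sym sep)).
by have [B1|B2] := bicon_sep sep bB BA; [left|right]; apply/block_ofP;
  split=> // X XA; apply: maxB; apply: subset_trans XA _.
Qed.

(** * The odd case *)

Definition odd_blocks (G : sgraph) (A : {set G}) : Prop :=
  forall B, block_of A B -> odd_clique B.

Lemma near_perfect_side (G : sgraph) (A A1 A2 : {set G}) v m :
  separation A A1 A2 v -> near_perfect A m v -> near_perfect A1 m v.
Proof.
move=> sep nm; have [Av mv] := near_perfect_mem nm; have [mA fm] := nm.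
have [A1v _] := separation_mem sep; have [A1A _] := separation_sub sep.
split.
  apply: (matching_onI mA A1A) => x A1x; have [->|xv] := eqVneq x v.
    by rewrite mv.
  have [Amx _ _ xmx] := near_perfect_val nm (subsetP A1A x A1x) xv.
  exact: (separation_step sep A1x Amx xv xmx).
apply/setP=> x; move/setP/(_ x): fm; rewrite !inE.
have [->|xv] := eqVneq x v; first by rewrite A1v Av.
have [A1x|//] := boolP (x \in A1); by rewrite (subsetP A1A x A1x).
Qed.

Lemma slidable_side (G : sgraph) (A A1 A2 : {set G}) v m :
  separation A A1 A2 v -> near_perfect A2 m v -> slidable A set0 ->
  slidable A1 set0.
Proof.
move=> sep nm sA n u y [nA fn]; rewrite setD0 => A1y uy.
have [nA' fn'] := separation_matching (separation_sym sep) nm nA.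
have [A1A _] := separation_sub sep.
have Dy : y \in A :\: set0 by rewrite setD0 (subsetP A1A).
have := sA _ u y (conj nA' (etrans fn' fn)) Dy uy.
by rewrite A1y.
Qed.

(** In the biconnected case [nbr_clique] applies at each vertex [a] of [A], so
    adjacency is transitive on [A] and, [A] being connected, [A] is a clique. *)
Lemma slidable_odd_blocks (G : sgraph) (A : {set G}) m u :
  conn A -> slidable A set0 -> near_perfect A m u -> odd_blocks A.
Proof.
move=> cA sA nm; have A0 : A != set0.
  by have [Au _] := near_perfect_mem nm; apply/set0Pn; exists u.
move: A A0 cA m u sA nm.
apply: separation_ind => [A A0 bA | A A1 A2 v cA sep IH1 IH2] m u sA nm B.
  rewrite block_of_bicon // => /eqP ->{B}.
  have [cA /forall_inP cutA] := andP bA.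
  apply/odd_cliqueP; split.
    by have [mA fm] := nm; rewrite -(odd_unmatched mA) fm cards1.
  move=> x y Ax Ay xy.
  have [e|//] : y = x \/ adj x y; last by rewrite e eqxx in xy.
  apply: (conn_ind (S := fun z => z = x \/ adj x z) cA Ax _ _ Ay).
    by left.
  move=> a b Aa Ab ab [<-|xa]; first by right.
  have [->|bx] := eqVneq b x; [by left | right].
  have [m' nm'] := exists_near_perfect_at sA nm cA Aa.
  apply: (nbr_clique _ nm' (cutA a Aa) Ax Ab _ ab _); last by rewrite eq_sym.
    by move=> n w z nn /setDP[Az _]; apply: sA nn _; rewrite setD0.
  by rewrite adj_sym.
have [A1v _] := separation_mem sep; have [A1A _] := separation_sub sep.
have Av := subsetP A1A v A1v.
have [m' nm'] := exists_near_perfect_at sA nm cA Av.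
have sep' := separation_sym sep.
have [n1 n2] := (near_perfect_side sep nm', near_perfect_side sep' nm').
rewrite (block_of_separation _ sep) => /orP[].
  exact: (IH1 _ _ (slidable_side sep n2 sA) n1).
exact: (IH2 _ _ (slidable_side sep' n1 sA) n2).
Qed.

(** A chordless sequence in a clique has at most two vertices. *)
Lemma odd_clique_extremal (G : sgraph) (A : {set G}) :
  odd_clique A -> extremal A.
Proof.
case/odd_cliqueP=> oA kA L [cL uL eL].
have [m mA le1] : exists2 m, matching_on A m & #|unmatched A m| <= 1.
  apply: improvable_almost_perfect => m u w mA Au Aw mu mw uw.
  by apply: (swap_unmatched mA Au Aw mu mw); apply: kA.
exists m => //.
suff : #|A| <= 2 * size L by move: oA; lia.
have -> : #|A| = size (flatten L).
  by rewrite -(card_uniqP uL); apply: eq_card => x; rewrite eL.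
have {eL} LA : {subset flatten L <= A} by move=> x; rewrite eL.
elim: L cL uL LA => //= s L IHL /andP[/andP[_ cs] cL].
rewrite cat_uniq size_cat => /and3P[us _ uL] sLA.
have leL : size (flatten L) <= 2 * size L.
  by apply: IHL => // x xL; apply: sLA; rewrite mem_cat xL orbT.
rewrite mulnS; apply: leq_add leL.
case: s cs us sLA => [|x [|y [|z s]]] //= cs us sLA.
case/andP: cs => /and3P[_ /negP nxz _] _; case: nxz; apply: kA.
- by apply: sLA; rewrite !inE eqxx.
- by apply: sLA; rewrite !inE eqxx !orbT.
by move: us; rewrite !inE !negb_or => /andP[/and3P[]].
Qed.

Lemma odd_blocks_extremal (G : sgraph) (A : {set G}) :
  A != set0 -> conn A -> odd_blocks A -> extremal A /\ odd #|A|.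
Proof.
move: A; apply: separation_ind => [A A0 bA oA | A A1 A2 v cA sep IH1 IH2 oA].
  have kA : odd_clique A by apply: oA; rewrite block_of_bicon.
  by split; [exact: odd_clique_extremal | case/odd_cliqueP: kA].
have [e1 o1] : extremal A1 /\ odd #|A1|.
  by apply: IH1 => B B1; apply: oA; rewrite (block_of_separation _ sep) B1.
have [e2 o2] : extremal A2 /\ odd #|A2|.
  by apply: IH2 => B B2; apply: oA; rewrite (block_of_separation _ sep) B2 orbT.
have cardA := separation_card sep.
split; last by move: cardA o1 o2; lia.
have [_ _ _ [c1 _] _] := sep; have [A1v _] := separation_mem sep.
have [m [u nm]] := extremal_odd_near_perfect e1 c1 o1.
have [m' nm'] := exists_near_perfect_at (extremal_slidable e1 o1) nm c1 A1v.
exact: (extremal_glue sep nm' o1 e1 e2).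
Qed.

(** * The even case *)

Definition odd_blocks_but_one (G : sgraph) (A : {set G}) : Prop :=
  exists B, [/\ block_of A B, ~~ odd_clique B,
    forall C, block_of A C -> C != B -> odd_clique C,
    ~~ odd #|B| & extremal B].

Lemma odd_clique1 (G : sgraph) (B : {set G}) v :
  B != set0 -> B \subset [set v] -> odd_clique B.
Proof.
move=> B0; rewrite subset1 (negPf B0) orbF => /eqP->.
apply/odd_cliqueP; rewrite cards1; split=> // x y /set1P-> /set1P->.
by rewrite eqxx.
Qed.

(** The side without the exceptional block is odd and extremal, so it can be
    glued to the other side, which is extremal by induction. *)
Lemma odd_blocks_but_one_extremal (G : sgraph) (A : {set G}) :
  A != set0 -> conn A -> odd_blocks_but_one A -> extremal A.
Proof.
move: A; apply: separation_ind => [A A0 bA|].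
  by case=> B [+ _ _ _ eB]; rewrite block_of_bicon // => /eqP <-.
suff half (A A1 A2 : {set G}) v B : conn A -> separation A A1 A2 v ->
    (odd_blocks_but_one A2 -> extremal A2) -> block_of A2 B ->
    ~~ odd_clique B -> (forall C, block_of A C -> C != B -> odd_clique C) ->
    ~~ odd #|B| -> extremal B -> extremal A.
  move=> A A1 A2 v cA sep IH1 IH2 [B [+ nB othB evB eB]].
  rewrite (block_of_separation _ sep) => /orP[B1|B2].
    exact: (half A A2 A1 v B cA (separation_sym sep)).
  exact: (half A A1 A2 v B cA sep).
move=> cA sep IH2 B2 nB othB evB eB.
have e2 : extremal A2.
  apply: IH2; exists B; split=> // C C2; apply: othB.
  by rewrite (block_of_separation _ sep) C2 orbT.
have [_ _ _ [c1 _] [gt1 _]] := sep; have [A1v _] := separation_mem sep.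
have A10 : A1 != set0 by apply/set0Pn; exists v.
have ob1 : odd_blocks A1.
  move=> C C1; apply: othB; first by rewrite (block_of_separation _ sep) C1.
  apply: contraNneq nB => eCB; rewrite eCB in C1.
  case/block_ofP: C1 => BA1 B0 _ _; case/block_ofP: B2 => BA2 _ _ _.
  apply: (odd_clique1 (v := v) B0); apply/subsetP=> x Bx; apply/set1P.
  by apply: (separation_only sep); [apply: (subsetP BA1)|apply: (subsetP BA2)].
have [e1 o1] := odd_blocks_extremal A10 c1 ob1.
have [m [u nm]] := extremal_odd_near_perfect e1 c1 o1.
have [m' nm'] := exists_near_perfect_at (extremal_slidable e1 o1) nm c1 A1v.
exact: (extremal_glue sep nm' o1 e1 e2).
Qed.

(** The paths [L] cover [m2 v] together with the vertices [s] of the odd side;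
    the edges of [n] and [m2] elsewhere complete them to a path partition of
    [A], which has at least [#|A| / 2] paths by extremality. *)
Lemma pendant_count (G : sgraph) (A A1 A2 : {set G}) v m2 n u s L :
  extremal A -> separation A A1 A2 v -> matching_on A2 m2 ->
  unmatched A2 m2 = set0 -> near_perfect A1 n u ->
  flatten L = m2 v :: s -> all (fun s => (s != [::]) && chordless s) L ->
  uniq (m2 v :: s) -> v \in s -> u \in s -> {subset s <= A1} ->
  {in s, forall x, n x \in s} ->
  (size s).+1 <= 2 * size L.
Proof.
move=> eA sep m2A f2 nn fL cL us vs us' sA1 ns; have [nA fn] := nn.
have [A1A A2A] := separation_sub sep; have [A1v A2v] := separation_mem sep.
have [UA _ _ _ _] := sep.
have [A2w m2w vw] := m2A v A2v.
pose X := [set x in m2 v :: s].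
have XA : X \subset A.
  apply/subsetP=> x; rewrite !inE => /predU1P[->|/sA1].
    exact: (subsetP A2A).
  exact: (subsetP A1A).
have pX : path_partition X L by split; rewrite ?fL // => x; rewrite /X !inE.
have n1 : matching_on (A1 :\: [set x in s]) n.
  by apply: matching_onD => // x; rewrite !inE => /ns.
have n2 : matching_on (A2 :\: [set v; m2 v]) m2.
  by apply: matching_onD => // x /set2P[]-> _; rewrite !inE ?m2w eqxx ?orbT.
have d : [disjoint A1 :\: [set x in s] & A2 :\: [set v; m2 v]].
  rewrite -setI_eq0; apply/eqP/setP=> x; rewrite !inE negb_or -!andbA.
  apply/and5P => -[xs A1x xv _ A2x].
  by rewrite (separation_only sep A1x A2x) eqxx in xv.
have wA1 : m2 v \notin A1.
  apply/negP=> A1w; move/setP/(_ v): f2; rewrite !inE A2v.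
  by rewrite (separation_only sep A1w A2w) eqxx.
have eD : (A1 :\: [set x in s]) :|: (A2 :\: [set v; m2 v]) = A :\: X.
  apply/setP=> x; rewrite -UA !inE !negb_or.
  have [A1x|A1x] := boolP (x \in A1).
    have xw : x != m2 v by apply: contraNneq wA1 => <-.
    rewrite xw !andbT /=; case: (boolP (x \in s)) => //= xs.
    rewrite andbC; apply/andP => -[A2x].
    by rewrite (separation_only sep A1x A2x) eqxx.
  rewrite !andbF /=; have -> : x \notin s by apply: contra A1x => /sA1.
  have xv : x != v by apply: contraNneq A1x => ->.
  by rewrite xv andbT.
have [] := matching_onU d n1 n2; rewrite eD; set mm := (fun x => _) => mD fD.
have [m' mA' le'] := extremal_patch eA XA pX mD.
have f0 : unmatched (A :\: X) mm = set0.
  rewrite fD; apply/setP=> x; rewrite !inE; apply/negP => /orP[].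
    case/andP=> /andP[xs A1x]; rewrite (near_perfectE nn A1x) => /eqP xu.
    by rewrite xu us' in xs.
  by case/andP=> /andP[_ A2x] fx; move/setP/(_ x): f2; rewrite !inE A2x fx.
rewrite f0 cards0 addn0 in le'; apply: leq_trans le'.
by rewrite cardsE (card_uniqP us) leq_addr.
Qed.

(** Rigidity for slides to [y] other than [v] holds because [w = m2 v] can be
    attached to any path of [A1] ending at [v]. If the slide from [u] to
    [y] were blocked, then the following induced paths would gain an edge, where
    [y'] is the partner of [y]: [w v y y'] if [u] is [v]; [w v y u] if [y'] is
    [v]; and otherwise [w v v'] together with [u y y'], where [v'] is the
    partner of [v]. Slides onto [v] cannot be handled in this way, as [v]
    would become an inner vertex of its path. But weak rigidity suffices for
    [nbr_clique], by which [u] is adjacent to the partner of [v]. *)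
Lemma pendant_slidable (G : sgraph) (A A1 A2 : {set G}) v m1 m2 :
  extremal A -> separation A A1 A2 v -> matching_on A2 m2 ->
  unmatched A2 m2 = set0 -> near_perfect A1 m1 v -> conn (A1 :\ v) ->
  slidable A1 set0.
Proof.
move=> eA sep m2A f2 nm1 cD.
have [A1v A2v] := separation_mem sep.
have [A2w m2w vw] := m2A v A2v.
have wNv : m2 v != v.
  by apply/negP=> e; move/setP/(_ v): f2; rewrite !inE A2v e.
have {}vw : adj v (m2 v) by case: vw => // e; rewrite e eqxx in wNv.
have wA1 : m2 v \notin A1.
  by apply: contraNN wNv => A1w; rewrite {1}(separation_only sep A1w A2w).
have wN x : x \in A1 -> x != m2 v by move=> A1x; apply: contraNneq wA1 => <-.
have nw x : x \in A1 -> x != v -> ~~ adj (m2 v) x.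
  by move=> A1x xv; rewrite adj_sym; have [_ _ nA _ _] := sep; apply: nA.
have weak : slidable A1 [set v].
  move=> n u y nn /setDP[A1y]; rewrite inE => yv uy.
  case: (boolP (adj u (n y))) => // uny; exfalso.
  have [A1u nu] := near_perfect_mem nn; have uNy := adj_neq uy.
  rewrite eq_sym in uNy; have [A1ny nyu nny yny] := near_perfect_val nn A1y uNy.
  have yNny := adj_neq yny.
  have count s L := pendant_count (s := s) (L := L) eA sep m2A f2 nn.
  (* The path w v y y'. *)
  have [uv|uv] := eqVneq u v.
    rewrite uv in uy uny nu nyu.
    suff : (size [:: v; y; n y]).+1 <= 2 * size [:: [:: m2 v; v; y; n y]] by [].
    apply: count => //.
    - by rewrite /= (adj_sym (m2 v)) vw !nw // uy uny yny.
    - by rewrite /= !inE !negb_or wNv (eq_sym (m2 v)) wN // (eq_sym (m2 v)) wN //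
         (eq_sym v) yv (eq_sym v) nyu yNny.
    - by rewrite !inE eqxx.
    - by rewrite uv !inE eqxx.
    - by move=> x; rewrite !inE => /or3P[]/eqP->.
    by move=> x; rewrite !inE => /or3P[]/eqP->; rewrite ?nu ?nny eqxx ?orbT.
  (* The path w v y u. *)
  have [nyv|nyv] := eqVneq (n y) v.
    suff : (size [:: v; y; u]).+1 <= 2 * size [:: [:: m2 v; v; y; u]] by [].
    have nv : n v = y by rewrite -nyv.
    rewrite nyv in yny uny.
    apply: count => //.
    - by rewrite /= (adj_sym (m2 v)) vw !nw // (adj_sym v y) yny (adj_sym v u) uny
         (adj_sym y u) uy.
    - by rewrite /= !inE !negb_or wNv (eq_sym (m2 v)) wN // (eq_sym (m2 v)) wN //
         (eq_sym v) yv (eq_sym v) uv uNy.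
    - by rewrite !inE eqxx.
    - by rewrite !inE eqxx !orbT.
    - by move=> x; rewrite !inE => /or3P[]/eqP->.
    by move=> x; rewrite !inE => /or3P[]/eqP->; rewrite ?nu ?nyv ?nv eqxx ?orbT.
  (* The paths w v v' and u y y'. *)
  have vu : v != u by rewrite eq_sym.
  have [A1nv nvu nnv vnv] := near_perfect_val nn A1v vu.
  have nvv := adj_neq vnv.
  suff : (size [:: v; n v; u; y; n y]).+1 <=
         2 * size [:: [:: m2 v; v; n v]; [:: u; y; n y]] by [].
  have [nA _] := nn.
  have nvy : n v != y by apply: contraNneq nyv => <-; rewrite nnv.
  have nvny : n v != n y by rewrite (matching_on_inj nA) // eq_sym.
  apply: count => //.
  - by rewrite /= (adj_sym (m2 v)) vw nw // 1?eq_sym // vnv uy uny yny.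
  - rewrite /= !inE !negb_or wNv nvv vu nvu nvy nvny yNny.
    rewrite !(eq_sym (m2 v)) !wN // (eq_sym v y) yv (eq_sym v) nyv.
    by rewrite (eq_sym u y) uNy (eq_sym u) nyu.
  - by rewrite !inE eqxx.
  - by rewrite !inE eqxx !orbT.
  - by move=> x; rewrite !inE => /or4P[|||/orP[]]/eqP->.
  by move=> x; rewrite !inE => /or4P[|||/orP[]]/eqP->;
     rewrite ?nu ?nny ?nnv eqxx ?orbT.
move=> n u y nn; rewrite setD0 => A1y uy.
have [yv|yv] := eqVneq y v; last by apply: weak nn _ uy; rewrite !inE yv.
rewrite yv in A1y uy *; have [A1u nu] := near_perfect_mem nn.
have vu : v != u by rewrite eq_sym adj_neq.
have [A1nv nvu nnv vnv] := near_perfect_val nn A1v vu.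
apply: (nbr_clique weak nm1 cD A1u A1nv); rewrite // 1?eq_sym //.
by rewrite adj_sym.
Qed.

(** Of two vertices in different components of [A] minus [v], one is not in the
    component of the partner of [v]; its component is the [C] that is split
    off. *)
Lemma even_extremal_blocks (G : sgraph) (A : {set G}) :
  A != set0 -> conn A -> extremal A -> ~~ odd #|A| -> odd_blocks_but_one A.
Proof.
have [k] := ubnP #|A|; elim: k A => // k IHk A ltA A0 cA eA oA.
have [bA|nbA] := boolP (bicon A).
  exists A; split=> //; first by rewrite block_of_bicon.
    by rewrite /odd_clique (negPf oA).
  by move=> C; rewrite block_of_bicon // => ->.
have [v [x [y [Av Dx Dy xy]]]] := not_biconP cA nbA.
have [m mA fm] := extremal_even_perfect eA cA oA.
have [Aw mw vw] := mA v Av.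
have mz z : z \in A -> m z != z.
  by move=> Az; apply/negP=> e; move/setP/(_ z): fm; rewrite !inE Az e.
have {}vw : adj v (m v) by case: vw => // e; have := mz v Av; rewrite e eqxx.
have Dw : m v \in A :\ v by rewrite !inE Aw mz.
have [z Dz zw] : exists2 z, z \in A :\ v & ~~ connect (within (A :\ v)) z (m v).
  have [xw|] := boolP (connect (within (A :\ v)) x (m v)); last by exists x.
  exists y => //; apply: contra xy => yw; apply: connect_trans xw _.
  by rewrite (sym_connect_sym (within_sym _)).
have [C [sep cC Cz Cw vC]] := component_separation cA Av Dz Dw zw.
set A1 := v |: C in sep; set A2 := A :\: C in sep.
have [A1A A2A] := separation_sub sep; have [A1v A2v] := separation_mem sep.
have CA1 : C \subset A1 by apply: subsetUr.
have CA := subset_trans CA1 A1A.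
have mC c : c \in C -> m c \in C.
  move=> Cc; have Ac := subsetP CA c Cc.
  have [Amc mmc cmc] := mA c Ac.
  have cv : c != v by apply: contraNneq vC => <-.
  have {}cmc : adj c (m c).
    by case: cmc => // e; have := mz c Ac; rewrite e eqxx.
  have := separation_step sep (subsetP CA1 c Cc) Amc cv cmc.
  by case/setU1P=> // e; rewrite -e mmc Cc in Cw.
have m2A : matching_on A2 m by apply: matching_onD => // c /mC.
have f2 : unmatched A2 m = set0.
  apply/setP=> c; move/setP/(_ c): fm; rewrite !inE => e.
  by rewrite -andbA e andbF.
have mCm : matching_on C m by apply: (matching_onI mA).
have [m1 nm1] : exists m1, near_perfect A1 m1 v.
  have d1 : [disjoint [set v] & C] by rewrite disjoints1.
  have [] := matching_onU d1 (@matching_on_id _ [set v]) mCm.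
  set m1 := (fun x => _) => m1A f1; exists m1; split=> //; rewrite f1.
  apply/setP=> c; rewrite !inE eqxx andbT; case: (boolP (c \in C)) => //= Cc.
    by rewrite (negPf (mz c (subsetP CA c Cc))) orbF.
  by rewrite orbF.
have cD : conn (A1 :\ v) by rewrite /A1 setU1K.
have s1 := pendant_slidable eA sep m2A f2 nm1 cD.
have [_ _ _ [c1 c2] [gt1 gt2]] := sep.
have ob1 := slidable_odd_blocks c1 s1 nm1.
have o1 : odd #|A1|.
  by have [m1A f1] := nm1; rewrite -(odd_unmatched m1A) f1 cards1.
have cardA := separation_card sep.
have e2 : extremal A2.
  move=> L pL; exists m => //; rewrite f2 cards0 addn0.
  have eC : A :\: A2 = C by rewrite /A2 setDDr setDv set0U (setIidPr CA).
  have mC' : matching_on (A :\: A2) m by rewrite eC.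
  have [m' _ le'] := extremal_patch eA A2A pL mC'.
  have fC : unmatched (A :\: A2) m = set0.
    apply/setP=> c; move/setP/(_ c): fm; rewrite eC !inE.
    by have [Cc|//] := boolP (c \in C); rewrite (subsetP CA c Cc).
  by rewrite fC cards0 addn0 in le'; apply: leq_trans le'; apply: leq_addr.
have lt2 : #|A2| < k by clear -cardA ltA gt1; lia.
have A20 : A2 != set0 by apply/set0Pn; exists v.
have o2 : ~~ odd #|A2| by clear -oA o1 cardA; lia.
have [B [B2 nB othB evB eB]] := IHk A2 lt2 A20 c2 e2 o2.
exists B; split=> //; first by rewrite (block_of_separation _ sep) B2 orbT.
by move=> D; rewrite (block_of_separation _ sep) => /orP[/ob1 // | /othB].
Qed.

Lemma extremal_structure (G : sgraph) (A : {set G}) :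
  A != set0 -> conn A ->
  extremal A <-> odd_blocks A \/ odd_blocks_but_one A.
Proof.
move=> A0 cA; split=> [eA|[oA|oA]].
- have [oA|oA] := boolP (odd #|A|); last by right; apply: even_extremal_blocks.
  left; have [m [u nm]] := extremal_odd_near_perfect eA cA oA.
  exact: slidable_odd_blocks cA (extremal_slidable eA oA) nm.
- by case: (odd_blocks_extremal A0 cA oA).
exact: odd_blocks_but_one_extremal.
Qed.

(** * From induced subgraphs to vertex subsets *)

Definition incl (G : sgraph) (A : {set G}) (x : induced A) : G := sval x.

Lemma incl_inj (G : sgraph) (A : {set G}) : injective (@incl G A).
Proof. exact: val_inj. Qed.

Lemma incl_mem (G : sgraph) (A : {set G}) (x : induced A) : incl x \in A.
Proof. exact: valP. Qed.

Lemma incl_adj (G : sgraph) (A : {set G}) (x y : induced A) :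
  adj (incl x) (incl y) = adj x y.
Proof. by []. Qed.

Lemma inclP (G : sgraph) (A : {set G}) (x : G) :
  x \in A -> exists y : induced A, incl y = x.
Proof. by move=> Ax; exists (exist _ x Ax). Qed.

Lemma incl_setT (G : sgraph) (A : {set G}) :
  [set incl x | x in [set: induced A]] = A.
Proof.
apply/setP=> x; apply/imsetP/idP => [[y _ ->]|/inclP[y <-]].
  exact: incl_mem.
by exists y; rewrite ?inE.
Qed.

Lemma incl_setTD1 (G : sgraph) (A : {set G}) (v : induced A) :
  [set incl x | x in [set: induced A] :\ v] = A :\ incl v.
Proof.
apply/setP=> x; apply/imsetP/setD1P => [[y]|[xv /inclP[y e]]].
  by case/setD1P=> yv _ ->; rewrite (inj_eq (@incl_inj G A)) incl_mem.
by exists y; rewrite // !inE -(inj_eq (@incl_inj G A)) e xv.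
Qed.

Lemma conn_incl (G : sgraph) (A : {set G}) (X : {set induced A}) :
  conn [set incl x | x in X] = conn X.
Proof.
apply/idP/idP => cX; apply/connP.
  move=> x y Xx Xy.
  pose S z := forall k, k \in X -> incl k = z -> connect (within X) x k.
  apply: (conn_ind (S := S) cX (imset_f _ Xx) _ _ (imset_f _ Xy)) => //.
    by move=> k _ /incl_inj->.
  move=> _ b /imsetP[a Xa ->] _ ab Sa k Xk kb; rewrite -kb in ab.
  by apply: connect_trans (Sa a Xa erefl) (connect1 _); rewrite /within Xa Xk.
move=> _ _ /imsetP[x Xx ->] /imsetP[y Xy ->].
pose S (z : induced A) : Prop :=
  connect (within [set incl k | k in X]) (incl x) (incl z).
apply: (conn_ind (S := S) cX Xx _ _ Xy).
  exact: connect0.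
move=> a b Xa Xb ab xa; apply: connect_trans xa (connect1 _).
by rewrite /within !imset_f // incl_adj.
Qed.

Lemma connected_setT (G : sgraph) : connected G = conn [set: G].
Proof.
have e : connect (@adj G) =2 connect (within [set: G]).
  by apply: eq_connect => x y; rewrite /within !inE.
apply/forallP/connP => [cG x y _ _|cG x]; first by rewrite -e (forallP (cG x)).
by apply/forallP => y; rewrite e cG ?inE.
Qed.

Lemma adj_connect_sym (G : sgraph) : connect_sym (@adj G).
Proof. exact/sym_connect_sym/adj_sym. Qed.

Lemma mem_rootsE (G : sgraph) (x : G) :
  (x \in predI (roots (@adj G)) (mem predT)) = (root (@adj G) x == x).
Proof. exact: andbT. Qed.

Lemma num_components_le1 (G : sgraph) : (num_components G <= 1) = connected G.
Proof.
have sG := @adj_connect_sym G.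
apply/card_le1P/idP => [le1|cG x].
  apply/forallP=> x; apply/forallP=> y; rewrite -(root_connect sG).
  have rG z : root (@adj G) z \in predI (roots (@adj G)) (mem predT).
    by rewrite mem_rootsE; apply/eqP/esym/(rootP sG)/connect_root.
  have := le1 _ (rG x) (root (@adj G) y); rewrite rG => /esym.
  by rewrite inE eq_sym.
rewrite mem_rootsE => /eqP rx y; rewrite mem_rootsE inE.
apply/eqP/eqP => [ry|->]; last exact: rx.
by rewrite -ry -rx; apply/(rootP sG); apply: (forallP (forallP cG y)).
Qed.

Lemma connected_set1C (G : sgraph) (v : G) :
  connected (induced [set~ v]) = conn ([set: G] :\ v).
Proof. by rewrite connected_setT -conn_incl incl_setT setTD. Qed.

(** A connected graph has one component, so a vertex that is not a cut-vertex is
    one whose removal leaves at most one component. *)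
Lemma biconnected_setT (G : sgraph) :
  0 < #|G| -> biconnected G = bicon [set: G].
Proof.
move=> G0; rewrite /biconnected /bicon -connected_setT.
have [cG|//] := boolP (connected G); rewrite /=.
have ncG : num_components G = 1.
  apply/eqP; rewrite eqn_leq num_components_le1 cG /=.
  have [x _] := card_gt0P G0; apply/card_gt0P; exists (root (@adj G) x).
  rewrite mem_rootsE; apply/eqP/esym/(rootP (@adj_connect_sym G)).
  exact: connect_root.
apply: eq_forallb => v; rewrite inE /= -connected_set1C -num_components_le1.
rewrite /cut_vertex ncG negb_and -!leqNgt.
have [le1|//] := leqP #|G| 1; rewrite orTb; apply/esym.
rewrite num_components_le1 connected_set1C; apply/connP=> x y.
rewrite !inE !andbT => xv; have /card_le1_eqP eqG := le1.
by rewrite (eqG x v) ?eqxx in xv.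
Qed.

Lemma biconnected_induced (G : sgraph) (A : {set G}) :
  A != set0 -> biconnected (induced A) = bicon A.
Proof.
rewrite -card_gt0 -card_induced => A0; rewrite biconnected_setT // /bicon.
rewrite -conn_incl incl_setT; congr (_ && _).
apply/forall_inP/forall_inP => cutA v.
  by case/inclP=> w <-; rewrite -incl_setTD1 conn_incl cutA ?inE.
by move=> _; rewrite -conn_incl incl_setTD1 cutA ?incl_mem.
Qed.

Lemma is_block_setT (G : sgraph) (B : {set G}) :
  is_block B = block_of [set: G] B.
Proof.
apply: maxset_eq => X; rewrite subsetT /=; case: eqVneq => //= X0.
exact: biconnected_induced.
Qed.

Lemma odd_complete_induced (G : sgraph) (A : {set G}) :
  odd_complete (induced A) = odd_clique A.
Proof.
rewrite /odd_complete /odd_graph card_induced.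
apply/andP/odd_cliqueP => -[oA cA].
  split=> // _ _ /inclP[x <-] /inclP[y <-] xy.
  rewrite incl_adj; apply: (implyP (forallP (forallP cA x) y)).
  by rewrite -(inj_eq (@incl_inj G A)).
split=> //; apply/forallP=> x; apply/forallP=> y; apply/implyP=> xy.
by rewrite -incl_adj cA ?incl_mem // (inj_eq (@incl_inj G A)).
Qed.

Lemma chordless_nth (G : sgraph) (x0 : G) (s : seq G) :
  reflect (forall i j, i < j < size s ->
             adj (nth x0 s i) (nth x0 s j) = (i.+1 == j))
    (chordless s).
Proof.
elim: s => [|x s IHs] /=; first by apply: ReflectT => i j; rewrite ltn0 andbF.
apply: (iffP andP) => [[xs /IHs cs] [|i] [|j] //= |cs].
- rewrite ltnS eqSS => js; case: s xs js {IHs cs} => //= y s /andP[xy xs].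
  by case: j => //= j js; apply/negbTE/(allP xs)/mem_nth.
- by rewrite !ltnS eqSS; apply: cs.
split; last by apply/IHs => i j ij; apply: (cs i.+1 j.+1).
case: s cs {IHs} => //= y s cs; rewrite (cs 0 1) //=.
apply/allP => z /(nthP x0)[k ks <-].
by rewrite (cs 0 k.+2).
Qed.

Lemma chordless_map (G H : sgraph) (f : G -> H) (s : seq G) :
  (forall x y, adj (f x) (f y) = adj x y) ->
  chordless (map f s) = chordless s.
Proof.
move=> fE; elim: s => //= x s ->; case: s => //= y s; rewrite fE all_map.
by congr (_ && _ && _); apply: eq_all => z /=; rewrite fE.
Qed.

Lemma is_pathP (G : sgraph) :
  reflect (exists s : seq G, [/\ s != [::], chordless s, uniq s & s =i G])
    (is_path G).
Proof.
apply: (iffP andP) => [[G0 /existsP[f /andP[/injectiveP fI /forallP fE]]]|].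
  have szf : size (codom f) = #|G| by rewrite size_codom card_ord.
  have uf : uniq (codom f) by apply/injectiveP.
  have [x0 _] := card_gt0P G0.
  exists (codom f); split=> //; first by rewrite -size_eq0 szf -lt0n.
    apply/(chordless_nth x0) => i j; rewrite szf => /andP[ij jn].
    have nthf k (kn : k < #|G|) : nth x0 (codom f) k = f (Ordinal kn).
      rewrite codomE (nth_map (Ordinal kn)) ?size_enum_ord //.
      by rewrite -[in RHS](nth_ord_enum (Ordinal kn) (Ordinal kn)).
    rewrite (nthf i (ltn_trans ij jn)) (nthf j jn).
    rewrite (eqP (forallP (fE _) _)) /=; case: eqVneq => //= _.
    by apply/eqP => e; move: ij; rewrite -e; lia.
  by move=> x; rewrite (inj_card_onto fI) ?card_ord.
case=> s [s0 cs us sG].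
have szs : size s = #|G| by rewrite -(card_uniqP us); apply: eq_card.
have G0 : 0 < #|G| by rewrite -szs lt0n size_eq0.
split=> //; have [x0 _] := card_gt0P G0.
apply/existsP; exists [ffun i : 'I_#|G| => nth x0 s i]; apply/andP; split.
  apply/injectiveP => i j; rewrite !ffunE => /eqP.
  by rewrite nth_uniq ?szs // => /eqP/val_inj.
apply/forallP=> i; apply/forallP=> j; rewrite !ffunE.
have /chordless_nth-/(_ x0) cE := cs; rewrite szs in cE.
have [ij|ji|->] := ltngtP i j.
- by rewrite cE ?ij //= [j.+1 == i]gtn_eqF ?orbF // ltnW.
- by rewrite adj_sym cE ?ji //= [i.+1 == j]gtn_eqF // ltnW.
by rewrite adj_irrefl orbb gtn_eqF.
Qed.

(** * From path partitions and matchings to lists and involutions *)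

Definition path_set (G : sgraph) (X : {set G}) : Prop :=
  exists s : seq G, [/\ s != [::], chordless s, uniq s & s =i X].

Lemma map_incl (G : sgraph) (A : {set G}) (s : seq G) :
  {subset s <= A} -> exists s' : seq (induced A), map (@incl G A) s' = s.
Proof.
elim: s => [|x s IHs] sA; first by exists [::].
have [y yx] := inclP (sA x (mem_head x s)).
have [s' <-] := IHs (fun z zs => sA z (@mem_behead _ (x :: s) z zs)).
by exists (y :: s'); rewrite -yx.
Qed.

Lemma is_path_induced (G : sgraph) (X : {set G}) :
  reflect (path_set X) (is_path (induced X)).
Proof.
have mapE (s : seq (induced X)) := chordless_map s (@incl_adj G X).
apply: (iffP (is_pathP _)) => -[s [s0 cs us sX]].
  exists (map (@incl G X) s); rewrite mapE (map_inj_uniq (@incl_inj G X)).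
  split=> //; first by case: (s) s0.
  move=> x; apply/mapP/idP => [[y _ ->]|/inclP[y <-]]; first exact: incl_mem.
  by exists y; rewrite ?sX.
have [|s' es] := @map_incl G X s; first by move=> x; rewrite sX.
rewrite -es mapE in cs; rewrite -es (map_inj_uniq (@incl_inj G X)) in us.
exists s'; split=> //; first by move: s0; rewrite -es; case: (s').
move=> x; rewrite -(mem_map (@incl_inj G X)) es sX.
by rewrite incl_mem.
Qed.

Lemma partition_path_list (G : sgraph) (A : {set G}) (P : {set {set G}}) :
  partition P A -> (forall X, X \in P -> is_path (induced X)) ->
  exists2 L, path_partition A L & size L = #|P|.
Proof.
have [n] := ubnP #|P|; elim: n P A => // n IHn P A ltP partP pathP.
have [P0|[X PX]] := set_0Vmem P.
  rewrite P0 /partition /cover big_set0 in partP.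
  have {partP} /andP[/eqP <- _] := partP.
  by exists [::]; rewrite ?P0 ?cards0 //; split=> // x; rewrite inE.
have [s [s0 cs us sX]] := is_path_induced _ (pathP X PX).
have [||Y /setD1P[_ /pathP//]|L pL szL] := IHn (P :\ X) (A :\: X).
- by move: ltP; rewrite (cardsD1 X) PX.
- exact: partitionD1.
exists ([:: s] ++ L); last by rewrite /= szL (cardsD1 X P) PX.
have XA := partitionS partP PX.
have eX : X = [set x in s] by apply/setP=> x; rewrite inE sX.
have dX : [disjoint X & A :\: X] by rewrite -setI_eq0 setIDA setDIl setDv set0I.
rewrite -(setID A X) (setIidPr XA).
by apply: path_partitionU => //; rewrite eX; apply: path_partition1.
Qed.

Lemma path_list_partition (G : sgraph) (A : {set G}) L :
  path_partition A L ->
  exists P : {set {set G}}, [/\ partition P A,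
    forall X, X \in P -> is_path (induced X) & #|P| <= size L].
Proof.
elim: L A => [|s L IHL] A [cL uL eL].
  exists set0; split=> //; last 2 first.
  - by move=> X; rewrite inE.
  - by rewrite cards0.
  have -> : A = set0 by apply/setP=> x; rewrite -eL inE.
  by rewrite partition_set0.
have /andP[/andP[s0 cs] cL'] := cL.
move: uL; rewrite cat_uniq => /and3P[us /hasPn sL uL].
have [|P [partP pathP leP]] := IHL [set x in flatten L].
  by split=> // x; rewrite inE.
pose X := [set x in s].
exists (X |: P); split.
- have -> : A = X :|: [set x in flatten L].
    by apply/setP=> x; rewrite -eL mem_cat !inE.
  apply: partitionU1 => //.
    by case: (s) s0 @X => // x t _; apply/set0Pn; exists x; rewrite !inE eqxx.
  rewrite -setI_eq0; apply/eqP/setP => x; rewrite !inE; apply/andP => -[xs xL].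
  by have := sL x xL; rewrite xs.
- move=> Y /setU1P[->|/pathP //]; apply/is_path_induced.
  by exists s; split=> // x; rewrite inE.
by rewrite cardsU1 /= -add1n leq_add // leq_b1.
Qed.

Lemma matching_edge (G : sgraph) (M : {set {set G}}) x y :
  is_matching M -> [set x; y] \in M -> adj x y.
Proof.
case/andP=> /subsetP sM _ /sM /imsetP[[a b] /[!inE] /= ab e].
have xy : x != y.
  apply/negP => /eqP exy; case/negP: (adj_neq ab).
  have ex z : z \in [set a; b] -> z = x by rewrite -e exy !inE orbb => /eqP.
  by rewrite (ex a (set21 a b)) (ex b (set22 a b)).
have [xa ya] : x \in [set a; b] /\ y \in [set a; b].
  by rewrite -e !inE !eqxx orbT.
case/set2P: xa xy => ->; case/set2P: ya => ->; rewrite ?eqxx // => _.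
by rewrite adj_sym.
Qed.

Lemma matching_card_cover (G : sgraph) (M : {set {set G}}) :
  is_matching M -> #|cover M| = 2 * #|M|.
Proof.
case/andP=> /subsetP sM /eqP <-; rewrite -sum1_card big_distrr /=.
apply: eq_bigr => _ /sM /imsetP[[a b] /[!inE] /= ab ->].
by rewrite cards2 adj_neq.
Qed.

Lemma matching_involution (G : sgraph) (M : {set {set G}}) :
  is_matching M ->
  exists2 m, matching_on [set: G] m
    & #|unmatched [set: G] m| + 2 * #|M| = #|G|.
Proof.
move=> mM; have /andP[sM /trivIsetP tM] := mM.
have same x y z : [set x; y] \in M -> [set x; z] \in M -> y = z.
  move=> Mxy Mxz; apply/eqP; apply: contraT => yz.
  have ne : [set x; y] != [set x; z].
    apply: contraNneq yz => e.
    have : y \in [set x; z] by rewrite -e !inE eqxx orbT.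
    rewrite !inE eq_sym (negPf (adj_neq (matching_edge mM Mxy))) /=.
    by [].
  have := disjointFr (tM _ _ Mxy Mxz ne) (set21 x y).
  by rewrite !inE eqxx.
pose m x := if [pick y | [set x; y] \in M] is Some y then y else x.
have mE x y : [set x; y] \in M -> m x = y.
  rewrite /m => Mxy; case: pickP => [z Mxz|/(_ y)]; first exact: same Mxz Mxy.
  by rewrite Mxy.
have mP x : [set x; m x] \in M \/ m x = x.
  by rewrite {1 2}/m; case: pickP => [z|_]; [left | right].
exists m.
  move=> x _; rewrite inE; case: (mP x) => [Mx|mx]; last first.
    by rewrite !mx; split=> //; left.
  split=> //; first by apply: mE; rewrite setUC.
  by right; apply: matching_edge Mx.
have -> : unmatched [set: G] m = ~: cover M.
  apply/setP=> x; rewrite !inE /=; apply/eqP/idP => [mx|xM].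
    apply/bigcupP => -[e Me xe].
    have [[a b] /[!inE] /= ab ee] := imsetP (subsetP sM e Me).
    rewrite ee in Me xe; case/set2P: xe => ex; subst x.
      by have := adj_neq ab; rewrite -(mE _ _ Me) mx eqxx.
    rewrite setUC in Me.
    by have := adj_neq ab; rewrite -(mE _ _ Me) mx eqxx.
  case: (mP x) => // Mx; case/negP: xM; apply/bigcupP.
  exists [set x; m x] => //.
  by rewrite !inE eqxx.
by rewrite -(matching_card_cover mM) addnC cardsC.
Qed.

Lemma involution_matching (G : sgraph) (m : G -> G) :
  matching_on [set: G] m ->
  exists2 M : {set {set G}}, is_matching M
    & #|G| = #|unmatched [set: G] m| + 2 * #|M|.
Proof.
move=> mG; have mm x : m (m x) = x by case: (mG x) => //; rewrite inE.
have adjm x : m x != x -> adj x (m x).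
  by case: (mG x) => [|_ _ []->]; rewrite ?inE ?eqxx.
pose M := [set [set x; m x] | x in ~: unmatched [set: G] m].
have mM : is_matching M.
  apply/andP; split.
    apply/subsetP=> _ /imsetP[x + ->]; rewrite !inE /= => mx.
    by apply/imsetP; exists (x, m x); rewrite // inE /=; apply: adjm.
  apply/trivIsetP=> _ _ /imsetP[x _ ->] /imsetP[y _ ->] ne.
  rewrite -setI_eq0; apply/eqP/setP=> z; rewrite !inE; apply/negP.
  case/andP=> /orP[]/eqP-> /orP[]/eqP e; case/eqP: ne.
  - by rewrite e.
  - by rewrite e mm setUC.
  - by rewrite -e mm setUC.
  by rewrite -(mm x) e mm.
exists M => //.
rewrite -(matching_card_cover mM) -(cardsC (unmatched [set: G] m)).
congr (_ + _); apply: eq_card => x.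
apply/idP/bigcupP => [Fx|[_ /imsetP[y Fy ->]]].
  by exists [set x; m x]; [exact: imset_f | rewrite !inE eqxx].
by case/set2P=> -> //; move: Fy; rewrite !inE /= mm eq_sym.
Qed.

(** A maximum matching, read as an involution, gives both the path partition
    that attains [#|G| - matching_number G] and the witness that [extremal]
    asks for. *)
Lemma indpp_extremalP (G : sgraph) :
  indpp_extremal G <-> extremal [set: G].
Proof.
rewrite /indpp_extremal /indpp; case: ex_minnP => k.
case/existsP=> P /andP[/andP[partP /forall_inP pathP] /eqP szP] mink.
have [M mM maxM] : exists2 M : {set {set G}}, is_matching M
    & #|M| = matching_number G.
  have M0 : is_matching (set0 : {set {set G}}).
    by rewrite /is_matching sub0set /trivIset /cover !big_set0 cards0.
  have gt0 : 0 < #|[pred M | @is_matching G M]| by apply/card_gt0P; exists set0.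
  have [M] := eq_bigmax_cond (fun M : {set {set G}} => #|M|) gt0.
  by rewrite inE => mM eM; exists M; rewrite // -eM.
have [m mG fm] := matching_involution mM; rewrite maxM in fm.
have cardT : #|[set: G]| = #|G| by rewrite cardsT.
have bound L : path_partition [set: G] L -> k <= size L.
  case/path_list_partition => Q [partQ pathQ leQ]; apply: leq_trans leQ.
  apply: mink; apply/existsP; exists Q; rewrite eqxx andbT /is_indpp partQ /=.
  exact/forall_inP.
split=> [/eqP ek L /bound leL|eG].
  exists m => //; rewrite cardT; lia.
have [L pL szL] := partition_path_list partP pathP.
have [m' m'G le'] := eG L pL.
have [M' mM' cM'] := involution_matching m'G.
have leM' : #|M'| <= matching_number G.
  by apply: (bigmax_sup M').
have [L2 pL2 szL2] := matching_cover mG.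
have leL2 := bound L2 pL2.
apply/eqP; rewrite cardT in le' szL2; lia.
Qed.

Lemma path_partition_incl (G : sgraph) (A : {set G})
    (L : seq (seq (induced A))) :
  path_partition [set: induced A] L <->
  path_partition A (map (map (@incl G A)) L).
Proof.
rewrite /path_partition -map_flatten (map_inj_uniq (@incl_inj G A)) all_map.
have -> :
    all (preim (map (@incl G A)) (fun s => (s != [::]) && chordless s)) L =
    all (fun s => (s != [::]) && chordless s) L.
  apply: eq_all => s /=; rewrite (chordless_map s (@incl_adj G A)).
  by case: s.
split=> -[cL uL eL]; split=> // x.
  apply/mapP/idP => [[y _ ->]|/inclP[y <-]]; first exact: incl_mem.
  by exists y; rewrite // eL inE.
by rewrite -(mem_map (@incl_inj G A)) eL incl_mem inE.
Qed.

Lemma extremal_induced (G : sgraph) (A : {set G}) :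
  extremal [set: induced A] <-> extremal A.
Proof.
have cT : #|[set: induced A]| = #|A| by rewrite cardsT card_induced.
split=> eA L pL.
  have [L' eL'] :
      exists L' : seq (seq (induced A)), map (map (@incl G A)) L' = L.
    have [_ _ eL] := pL.
    have {eL} LA : {subset flatten L <= A} by move=> x; rewrite eL.
    elim: L LA {pL} => [|s L IHL] LA; first by exists [::].
    have [|s' <-] := @map_incl G A s.
      by move=> x xs; apply: LA; rewrite mem_cat xs.
    have [|L' <-] := IHL; last by exists (s' :: L').
    by move=> x xL; apply: LA; rewrite mem_cat xL orbT.
  rewrite -eL' in pL.
  have [m mG le] := eA L' (proj2 (path_partition_incl L') pL).
  pose m' x := if insub x is Some y then incl (m y) else x.
  have m'E (y : induced A) : m' (incl y) = incl (m y) by rewrite /m' valK.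
  exists m'.
    move=> _ /inclP[y <-]; rewrite !m'E; have [_ mm my] := mG y (in_setT y).
    rewrite mm incl_mem incl_adj; split=> //.
    by case: my => [->|]; [left|right].
  have -> : unmatched A m' = [set incl y | y in unmatched [set: induced A] m].
    apply/setP=> x; rewrite !inE.
    apply/andP/imsetP => [[/inclP[y <-]]|[y + ->]].
      by rewrite m'E (inj_eq (@incl_inj G A)) => fy; exists y; rewrite // !inE.
    by rewrite !inE /= m'E (inj_eq (@incl_inj G A)) incl_mem.
  rewrite (card_imset _ (@incl_inj G A)) -cT; apply: leq_trans le _.
  by rewrite -eL' size_map.
have [m mG le] := eA _ (proj1 (path_partition_incl L) pL).
pose m' (x : induced A) : induced A := insubd x (m (incl x)).
have m'E y : incl (m' y) = m (incl y).
  have [Am _ _] := mG (incl y) (incl_mem y).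
  by rewrite /incl /m' [LHS]val_insubd Am.
exists m'.
  move=> y _; have [_ mm my] := mG (incl y) (incl_mem y).
  rewrite inE; split=> //; first by apply: incl_inj; rewrite !m'E.
  case: my => my; last by right; rewrite -incl_adj m'E.
  by left; apply: incl_inj; rewrite m'E.
have fE : [set incl y | y in unmatched [set: induced A] m'] = unmatched A m.
  apply/setP=> x; rewrite !inE; apply/imsetP/andP => [[y + ->]|[/inclP[y <-]]].
    by rewrite !inE /= -(inj_eq (@incl_inj G A)) m'E incl_mem.
  by rewrite -m'E (inj_eq (@incl_inj G A)) => fy; exists y; rewrite // !inE.
by rewrite -fE (card_imset _ (@incl_inj G A)) -cT size_map in le.
Qed.

(** * The characterization *)

Theorem theorem1p9 (G : sgraph) (G_nonnull : 0 < #|G|)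
    (G_connected : connected G) :
  indpp_extremal G <->
  (forall B : {set G}, is_block B -> odd_complete (induced B)) \/
  (exists B : {set G},
     [/\ is_block B,
         ~~ odd_complete (induced B),
         forall C : {set G}, is_block C -> C != B -> odd_complete (induced C),
         even_graph (induced B)
       & indpp_extremal (induced B)]).
Proof.
have T0 : [set: G] != set0 by rewrite -card_gt0 cardsT.
have cT : conn [set: G] by rewrite -connected_setT.
apply: (iff_trans (indpp_extremalP G)).
apply: (iff_trans (extremal_structure T0 cT)).
have all_odd : odd_blocks [set: G] <->
    (forall B : {set G}, is_block B -> odd_complete (induced B)).
  by split=> ob B; have := ob B; rewrite is_block_setT odd_complete_induced.
have evenE (B : {set G}) : even_graph (induced B) = ~~ odd #|B|.
  by rewrite /even_graph card_induced.
have extE (B : {set G}) : indpp_extremal (induced B) <-> extremal B.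
  exact: iff_trans (indpp_extremalP _) (extremal_induced B).
split=> -[/all_odd|[B [B1 B2 B3 B4 B5]]]; [by left | right | by left | right];
  exists B; split.
- by rewrite is_block_setT.
- by rewrite odd_complete_induced.
- by move=> C; rewrite is_block_setT odd_complete_induced; apply: B3.
- by rewrite evenE.
- exact/extE.
- by rewrite -is_block_setT.
- by rewrite -odd_complete_induced.
- by move=> C; rewrite -is_block_setT -odd_complete_induced; apply: B3.
- by rewrite -evenE.
exact/extE.
Qed.
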